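(* Let $(\mathbf M,T,\mathcal B,\mu)$ be a measure preserving system with generating partition $\mathcal A$ as in the context. Assume that $\{U_n\}$ is a good neighborhood system with $\pi_{\mathrm{ess}}(U_n)\to\infty$, and that $(T,\mu,\mathcal A)$ satisfies one of the following two assumptions: (1) $\mu$ is right $\phi$-mixing with respect to $\mathcal A$ with $\phi(k)\le Ck^{-p}$ for some $C>0$ and $p>1$; or (2) $T$ is Gibbs-Markov with respect to $\mathcal A$. Then the localized escape rate at $\Lambda=\bigcap_nU_n$ exists and satisfies $$\rho(\Lambda,\{U_n\})=1 .$$
   Context: Setting: $\mathbf M$ is a compact metric space, $\mathcal B$ its Borel $\sigma$-algebra, $T:\mathbf M\to\mathbf M$ a measurable map (not assumed invertible), $\mu$ a $T$-invariant probability measure, also written $\mathbb P$. $\mathcal A$ is a finite or countable measurable partition of $\mathbf M$, $\mathcal A^n=\bigvee_{j=0}^{n-1}T^{-j}\mathcal A$; elements of $\mathcal A^n$ are called $n$-cylinders, $A_n(x)$ is the $n$-cylinder containing $x$, and $\mathcal A$ is generating: $\bigcap_n A_n(x)=\{x\}$. $\sigma(\mathcal A^n)$ is the $\sigma$-algebra generated by the $n$-cylinders. Essential period: $\pi_{\mathrm{ess}}(U)=\min\{k>0:\mu(T^{-k}U\cap U)>0\}$. Right $\phi$-mixing: $|\mu(A\cap T^{-n-k}B)-\mu(A)\mu(B)|\le\phi(k)\mu(B)$ for all $n\in\mathbb N$, $A\in\sigma(\mathcal A^n)$ and $B\in\sigma(\bigcup_j\mathcal A^j)$, where $\phi(k)$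 decreases to $0$ as $k\to\infty$. Gibbs-Markov: $\mu(A)>0$ for all $A\in\mathcal A$; for every $A\in\mathcal A$, $T|_A$ is injective and $T(A)$ is a union of elements of $\mathcal A$; $T$ preserves $\mu$; (i) big image property: there is $C>0$ with $\mu(T(A))>C$ for all $A\in\mathcal A$; (ii) distortion: for a fixed $\lambda\in(0,1)$ and the metric $d_\lambda(x,y)=\lambda^{s(x,y)}$, where $s(x,y)$ is the largest positive integer $n$ such that $x,y$ lie in the same $n$-cylinder, the function $\log g|_A$, $g=\frac{d\mu}{d\mu\circ T}$, is $d_\lambda$-Lipschitz for all $A\in\mathcal A$, with a constant uniform in $A$. Entry time: $\tau_U(x)=\min\{j\ge1:T^j(x)\in U\}$ ($=\infty$ if there is no such $j$). Nested sequence: sets $U_n$ of positive measure with $U_{n+1}\subset U_n$ and $\mu(U_n)\to0$. Escape rate: $\rho(U)=\lim_{t\to\infty}\frac1t|\log\mathbb P(\tau_U>t)|$. Localized escape rate at $\Lambda=\bigcap_nU_n$: $\rho(\Lambda,\{U_n\})=\lim_{n\to\infty}\rho(U_n)/\mu(U_n)$. Good neighborhood system: a nested sequence $\{U_n\}$ such that each $U_n$ is a union of $\kappa_n$-cylinders for a non-decreasing sequence of integers $\kappa_n$, and (1) $\kappa_n\nearrow\infty$ and $\kappa_n\mu(U_n)^\varepsilon\to0$ for some $\varepsilon\in(0,1)$; (2) there exist $C>0$ and $p'>1$ with $\mu(U_n^j)\le\mu(U_n)+Cj^{-p'}$ for all $j<\kappa_n$, where $U_n^j=\bigcup\{A\in\mathcal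 A^j:A\cap U_n\neq\emptyset\}$.
   Formalization: Case (2) also assumes T ergodic (false otherwise). In case (1) ρ(U_n) need not exist: what is proved is that lower and upper exponential rates over μ(U_n) tend to 1, and ρ(U_n)/μ(U_n)→1 if ρ(U_n) exists for large n; in case (2) it always does. *)

(* Defs.v *)
(* MathComp world, with MathComp-Analysis. *)
From HB Require Import structures.
From mathcomp Require Import all_boot all_order all_algebra.
From mathcomp Require Import all_classical all_reals all_analysis.

Set Implicit Arguments.
Unset Strict Implicit.
Unset Printing Implicit Defensive.

Import Order.TTheory GRing.Theory Num.Theory.
Import numFieldNormedType.Exports.

Local Open Scope classical_set_scope.
Local Open Scope ring_scope.

(* The library's [metricType] is not pointed, whereas its measurable types are.
   Only spaces carrying a probability are considered, so asking for a base point
   loses nothing. *)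
#[short(type="pmetricType")]
HB.structure Definition PointedMetric (K : numDomainType) :=
  {M of Metric K M & isPointed M}.

Notation borelType M := (g_sigma_algebraType (@open M)).

Section cylinders.
Context {d : measure_display} {X : measurableType d}.
Variables (T : X -> X) (P : set (set X)).
Implicit Types (n : nat) (x y : X) (U : set X).

Definition measurable_partition :=
  [/\ countable P, forall A, P A -> measurable A & partition P id [set: X]].

Definition cylinders n : set (set X) :=
  [set Z | Z !=set0 /\
    exists2 a : nat -> set X, (forall j, (j < n)%N -> P (a j)) &
      Z = \bigcap_(j in `I_n) (iter j T @^-1` a j)].

(* When [P] is a partition, the union below has exactly one term. *)
Definition cylinder_at n x : set X :=
  \bigcup_(Z in [set Z | cylinders n Z /\ Z x]) Z.

Definition generating :=
  forall x, \bigcap_(n in [set: nat]) cylinder_at n x = [set x].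

Definition union_of (F : set (set X)) U :=
  exists2 G : set (set X), G `<=` F & U = \bigcup_(A in G) A.

Definition cylinder_hull U n : set X :=
  \bigcup_(A in [set A | cylinders n A /\ A `&` U !=set0]) A.

(* The value is 0 for points of distinct elements of [P]; it is meaningless for
   [x = y], a case that [sep_dist] treats apart. *)
Definition sep_time x y : nat :=
  xget 0%N [set n | cylinder_at n x y /\
                    forall m, cylinder_at m x y -> (m <= n)%N].

Definition sep_dist {R : realType} (lambda : R) x y : R :=
  if x == y then 0 else lambda ^+ sep_time x y.

End cylinders.

Section dynamics.
Context {d : measure_display} {X : measurableType d} {R : realType}.
Variables (mu : probability X R) (T : X -> X) (P : set (set X)).
Local Open Scope ereal_scope.
Implicit Types (U : set X).

Definition measure_preserving :=
  measurable_fun [set: X] T /\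
  forall B, measurable B -> mu (T @^-1` B) = mu B.

Definition ergodic :=
  forall B, measurable B -> T @^-1` B = B -> mu B = 0 \/ mu B = 1.

Definition right_phi_mixing (phi : nat -> R) :=
  [/\ nonincreasing_seq phi,
      phi @ \oo --> (0 : R)%R &
      forall (n k : nat) (A B : set X),
        <<s cylinders T P n >> A ->
        <<s \bigcup_(j in [set: nat]) cylinders T P j >> B ->
        `| mu (A `&` iter (n + k) T @^-1` B) - mu A * mu B | <=
          (phi k)%:E * mu B].

(* [nu] is the measure usually written mu o T: it is B |-> mu (T B) on the
   measurable subsets of each element of [P], hence
   nu B = \sum_(A in P) mu (T (A `&` B)) in general.  On a compact metric space,
   with [T] injective on each element of [P], the measurability of the images
   T B holds by the Lusin-Souslin theorem; it is required here because the
   library does not have that theorem. *)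
Definition is_mu_comp (nu : {measure set X -> \bar R}) :=
  forall A B, P A -> measurable B -> B `<=` A ->
    measurable (T @` B) /\ nu B = mu (T @` B).

(* [g] is a positive version of d mu / d (mu o T). *)
Definition is_jacobian (g : X -> R) :=
  [/\ measurable_fun [set: X] g,
      forall x, (0 < g x)%R &
      exists2 nu : {measure set X -> \bar R}, is_mu_comp nu &
        forall B, measurable B -> mu B = \int[nu]_(x in B) (g x)%:E].

Definition markov_map :=
  [/\ forall A, P A -> 0 < mu A,
      forall A, P A -> {in A &, injective T} &
      forall A, P A -> union_of P (T @` A)].

Definition big_images :=
  exists2 C : R, (0 < C)%R & forall A, P A -> C%:E < mu (T @` A).

Definition bounded_distortion :=
  exists lambda : R, exists g : X -> R,
    [/\ (0 < lambda < 1)%R, is_jacobian g &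
        exists K : R, forall A x y, P A -> A x -> A y ->
          (`| ln (g x) - ln (g y) | <= K * sep_dist T P lambda x y)%R].

Definition gibbs_markov :=
  [/\ markov_map, measure_preserving, big_images & bounded_distortion].

(* The least element of a set of times, +oo if there is none. *)
Definition first_time (S : set nat) : \bar R :=
  ereal_inf [set (k%:R : R)%:E | k in S].

Definition essential_period U : \bar R :=
  first_time [set k | (0 < k)%N /\ 0 < mu (iter k T @^-1` U `&` U)].

Definition entry_time U (x : X) : \bar R :=
  first_time [set j | (1 <= j)%N /\ U (iter j T x)].

(* [entry_time] takes its values in the integers and +oo, so it is enough to let
   t range over the integers.  [lne 0 = -oo]. *)
Definition escape_seq U (t : nat) : \bar R :=
  ((t%:R)^-1 : R)%:E * `| lne (mu [set x | (t%:R : R)%:E < entry_time U x]) |.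

(* Meaningful when [escape_seq U] converges in [\bar R]. *)
Definition escape_rate U : \bar R := limn (escape_seq U).
Definition lower_escape_rate U : \bar R := limn_einf (escape_seq U).
Definition upper_escape_rate U : \bar R := limn_esup (escape_seq U).

Definition nested (U : nat -> set X) :=
  [/\ forall n, 0 < mu (U n),
      forall n, U n.+1 `<=` U n &
      mu (U n) @[n --> \oo] --> 0].

Definition good_neighborhood_system (U : nat -> set X) :=
  nested U /\
  exists kappa : nat -> nat,
    [/\ nondecreasing_seq kappa,
        forall n, union_of (cylinders T P (kappa n)) (U n),
        kappa n @[n --> \oo] --> \oo,
        exists2 eps : R, (0 < eps < 1)%R &
          ((kappa n)%:R * fine (mu (U n)) `^ eps)%R @[n --> \oo] --> (0 : R)%R &
        exists C p : R, [/\ (0 < C)%R, (1 < p)%R &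
          forall n j, (0 < j < kappa n)%N ->
            mu (cylinder_hull T P (U n) j) <=
              mu (U n) + (C * j%:R `^ (- p))%:E]].

End dynamics.

(* Main.v *)
(* Let [u] be the measure of a hole [U], [S_t] the set of points that avoid [U]
   at the times [0, ..., t - 1], and [a_t] its measure.  Invariance gives
   [a_t - a_(t+1) = mu (U `&` T^-1 S_t)].  If [S_t] were independent of [U] this
   would be [u * a_t], and the escape rate would be [- ln (1 - u) ~ u].
   Independence holds approximately once a gap [D] much longer than the cylinders
   defining [U], but with [D * u] small, is opened after time [0]: the points of
   [U] that hit [U] again inside the gap have measure [o(u) * a_t], by the hull
   condition and the divergence of the essential period, and dropping a window of
   length [D] changes [a_t] by a factor [1 + O(D * u)] only.
   Right phi-mixing gives independence across the gap directly.  An ergodic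
   Gibbs-Markov map may permute cyclic classes, so independence is obtained
   only on average over a bounded window of gaps: bounded distortion reduces this
   to finitely many pairs of cylinders, for which it follows from the maximal
   ergodic inequality.  Bounded distortion also makes [a_t] submultiplicative up
   to a constant and a shift, whence the existence of the escape rates. *)
Require Import Defs.
From HB Require Import structures.
From mathcomp Require Import all_boot all_order all_algebra.
From mathcomp Require Import all_classical all_reals all_analysis.
From mathcomp Require Import measurable_realfun ring lra zify.

Set Implicit Arguments.
Unset Strict Implicit.
Unset Printing Implicit Defensive.

Import Order.TTheory GRing.Theory Num.Theory.
Import numFieldNormedType.Exports.
Local Open Scope classical_set_scope.
Local Open Scope ring_scope.

(** * Decay of the survival probabilities *)

(** Since [a_t] decays exponentially, every error has to be relative to [a_t]; an error [o(u)] alone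
    is useless for large [t]. This dictates the form of the mixing bounds, whose error is
    proportional to the measure of the future event, here a survivor set. It also explains the
    second gap: a point of the hole that returns at a time [j <= D] is decoupled once more, from its
    survival after time [2 * D + 1], and this supplies the factor [a]. The lags so created are
    undone in a definite order: the upper estimate of [a_t - a_(t+1)] alone bounds [a_(t+1) / a_t]
    from below, and only then can the lower estimate, lagged by [2 * D], be compared with [a_t]. For
    phi-mixing a gap of order [1 / u] makes [phi] of order [u ^ p], which is [o(u)] because [p > 1].
    In the Gibbs-Markov case ergodicity excludes the following: holes inside one of two invariant
    components of positive measure let the other component survive for ever, so that their escape
    rates vanish. *)

Section real_sequences.
Context {R : realType}.
Implicit Types (a c : nat -> R) (u e : R) (D t : nat).

Lemma ln1B_le (x : R) : x < 1 -> ln (1 - x) <= - x.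
Proof. by move=> x1; apply: (@le_ln1Dx _ (- x)); lra. Qed.

Lemma ln1B_ge (x : R) : x < 1 -> - (x / (1 - x)) <= ln (1 - x).
Proof.
move=> x1; have x1' : 0 < 1 - x by lra.
rewrite lerNl -lnV ?posrE//.
have e1 : (1 - x)^-1 = 1 + x / (1 - x) by field; lra.
rewrite [X in ln X]e1; apply: le_ln1Dx.
have -> : x / (1 - x) = (1 - x)^-1 - 1 by field; lra.
by rewrite ltrBrDr addNr invr_gt0.
Qed.

(** Bernoulli's inequality for a product of [k] one-step ratios. The ratio is assumed only before
    time [t], so that the lemma can serve inside a strong induction on [t]. *)
Lemma geometric_delay a u t k : (forall i, 0 <= a i) ->
  (forall i, (i < t)%N -> (1 - 2 * u) * a i <= a i.+1) ->
  0 <= u -> k%:R * u <= 2^-1 -> (k <= t)%N ->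
  (1 - 2 * k%:R * u) * a (t - k)%N <= a t.
Proof.
move=> a0 H u0; elim: k => [|k IH] ku kt; first by rewrite subn0; lra.
have ku' : k%:R * u <= 2^-1 by move: ku; rewrite -natr1; nra.
have {}IH := IH ku' (ltnW kt).
have e1 : (t - k = (t - k.+1).+1)%N by lia.
have h : (1 - 2 * u) * a (t - k.+1)%N <= a (t - k)%N.
  by rewrite e1; apply: H; lia.
have a1 := a0 (t - k.+1)%N.
apply: le_trans IH.
have k0 : 0 <= k%:R * u by rewrite mulr_ge0.
apply: (@le_trans _ _ ((1 - 2 * k%:R * u) * ((1 - 2 * u) * a (t - k.+1)%N))).
  rewrite mulrA ler_wpM2r// -natr1.
  suff : 0 <= 4 * (k%:R * u) * u by lra.
  by rewrite !mulr_ge0.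
by rewrite ler_wpM2l//; lra.
Qed.

(** Strong induction: by the ratios already known the lag [D] costs at most a factor [10 / 9], and
    [(1 + e) * 10 / 9] stays below the 2 of the conclusion. Before time [D] no lagged estimate is
    available, but there [a] is still close to [a 0 = 1]. *)
Lemma delay_ratio a u e D : a 0%N = 1 -> (forall t, 0 <= a t) ->
  (forall t, a t - a t.+1 <= u) ->
  (forall t, (D <= t)%N -> a t - a t.+1 <= (1 + e) * u * a (t - D)%N) ->
  0 <= u -> 0 <= e <= 20^-1 -> (0 < D)%N -> D%:R * u <= e ->
  forall t, (1 - 2 * u) * a t <= a t.+1.
Proof.
move=> a1 a0 dtu dtD u0 /andP[e0 e1] D0 Du.
elim/ltn_ind => t IH.
have [tD|Dt] := ltnP t D.
  have tu : t%:R * u <= 20^-1.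
    apply: le_trans e1; apply: le_trans Du.
    by rewrite ler_wpM2r// ler_nat ltnW.
  have : (1 - 2 * t%:R * u) * a (t - t)%N <= a t.
    by apply: geometric_delay => //; lra.
  by rewrite subnn a1; have := dtu t; nra.
have : (1 - 2 * D%:R * u) * a (t - D)%N <= a t.
  by apply: geometric_delay => //; lra.
have := dtD _ Dt; have := a0 (t - D)%N; have := a0 t.
move: (a t) (a t.+1) (a (t - D)%N) => x y z x0 z0 h1 h2.
have zx : z <= x / (1 - 2 * e).
  rewrite ler_pdivlMr; last lra.
  apply: le_trans h2; rewrite mulrC ler_wpM2r//; lra.
have : (1 + e) * u * z <= 2 * u * x.
  have : 9 / 10 * z <= x by apply: le_trans h2; rewrite ler_wpM2r//; lra.
  move=> h3; have : u * (9 / 10 * z) <= u * x by rewrite ler_wpM2l.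
  have : e * (u * z) <= 20^-1 * (u * z) by rewrite ler_wpM2r// mulr_ge0.
  have : 0 <= u * z by rewrite mulr_ge0.
  lra.
lra.
Qed.

Lemma linear_growth c (l1 l2 e : R) t0 :
  (forall t, (t0 <= t)%N -> l1 <= c t.+1 - c t <= l2) -> 0 < e ->
  \forall t \near \oo, l1 - e <= t%:R^-1 * c t <= l2 + e.
Proof.
move=> H e0.
have K k : l1 * k%:R <= c (t0 + k)%N - c t0 <= l2 * k%:R.
  elim: k => [|k /andP[IH1 IH2]]; first by rewrite addn0; lra.
  rewrite addnS -natr1; have /andP[h1 h2] := H (t0 + k)%N (leq_addr _ _).
  by lra.
near=> t.
have t_gt0 : (0 < t)%N by near: t; exists 1%N.
have tR : 0 < t%:R :> R by rewrite ltr0n.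
have tt0 : (t0 <= t)%N by near: t; exists t0.
have := K (t - t0)%N; rewrite subnKC// natrB//.
(* Beyond this threshold the terms inherited from the times up to [t0] amount to at most [e * t]. *)
have : (`|c t0| + `|l1| * t0%:R + `|l2| * t0%:R) / e <= t%:R.
  by near: t; exact: nbhs_infty_ger.
rewrite ler_pdivrMr// => B /andP[h1 h2].
rewrite ler_pdivlMl// ler_pdivrMl//.
have := ler_norm (c t0); have := ler_norm (- c t0); rewrite normrN => n1 n2.
have t00 : 0 <= t0%:R :> R by [].
have m1 : l1 * t0%:R <= `|l1| * t0%:R by rewrite ler_wpM2r// ler_norm.
have m2 : - l2 * t0%:R <= `|l2| * t0%:R by rewrite ler_wpM2r// -normrN ler_norm.
have m3 : 0 <= `|l1| * t0%:R by rewrite mulr_ge0.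
have m4 : 0 <= `|l2| * t0%:R by rewrite mulr_ge0.
by apply/andP; split; lra.
Unshelve. all: by end_near. Qed.

(* The recursion [a t - a t.+1 = mu (U `&` T^-1 S_t)] for the survivor sets
   [S_t] turns near independence at lag [D << 1 / u] into these hypotheses. *)
Lemma survival_rate a u e D : a 0%N = 1 -> (forall t, 0 <= a t) ->
  (forall t, a t - a t.+1 <= u) ->
  (forall t, (D <= t)%N -> a t - a t.+1 <= (1 + e) * u * a (t - D)%N) ->
  (forall t, (2 * D <= t)%N ->
    (1 - e) * u * a t - e * u * a (t - 2 * D)%N <= a t - a t.+1) ->
  0 < u -> 0 < e <= 20^-1 -> (0 < D)%N -> D%:R * u <= e ->
  (forall t, 0 < a t) /\
  \forall t \near \oo,
    (1 - 20 * e) * u <= t%:R^-1 * - ln (a t) <= (1 + 20 * e) * u.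
Proof.
move=> a1 a0 dtu dtD dtl u0 /andP[e0 e1] D0 Du.
have ratio t : (1 - 2 * u) * a t <= a t.+1.
  by apply: (@delay_ratio a u e D) => //; rewrite ltW.
have ue : u <= e.
  by apply: le_trans Du; rewrite ler_peMl ?(ltW u0)// ler1n.
have apos t : 0 < a t.
  elim: t => [|t IH]; first by rewrite a1.
  by apply: lt_le_trans (ratio t); rewrite mulr_gt0//; lra.
split => //.
have u1 : (1 + 4 * e) * u < 1 by nra.
have u2 : (1 - 3 * e) * u < 1 by nra.
have inc t : (2 * D <= t)%N ->
    (1 - 3 * e) * u <= - ln (a t.+1) - - ln (a t) <=
    (1 + 4 * e) * u / (1 - (1 + 4 * e) * u).
  move=> Dt; have a0' : 0 <= a t by exact: ltW.
  have delay k : (k <= t)%N -> (k <= 2 * D)%N ->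
      (1 - 2 * k%:R * u) * a (t - k)%N <= a t.
    move=> kt kD; apply: geometric_delay => //; first exact: ltW.
    have : k%:R * u <= (2 * D)%:R * u by rewrite ler_wpM2r ?ler_nat// ltW.
    by rewrite natrM; lra.
  have DD : (D <= 2 * D)%N by rewrite leq_pmull.
  have h1 := delay D (leq_trans DD Dt) DD.
  have h2 := delay (2 * D)%N Dt (leqnn _).
  have h3 := dtD t (leq_trans DD Dt).
  have h4 := dtl t Dt.
  have z1 := a0 (t - D)%N; have z2 := a0 (t - 2 * D)%N.
  (* The lag [D] costs a factor [1 / (1 - 2 * e)], and [(1 + e) / (1 - 2 * e) <= 1 + 4 * e] for
     these small [e]. *)
  have hi : a t - a t.+1 <= (1 + 4 * e) * u * a t.
    apply: le_trans h3 _; rewrite !(mulrAC _ u) ler_wpM2r ?(ltW u0)//.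
    have : (1 - 2 * e) * a (t - D)%N <= a t.
      by apply: le_trans h1; rewrite ler_wpM2r//; lra.
    move=> h; have : (1 + 4 * e) * ((1 - 2 * e) * a (t - D)%N) <=
      (1 + 4 * e) * a t by rewrite ler_wpM2l//; lra.
    apply: le_trans; rewrite mulrA ler_wpM2r//.
    have : e * e <= 20^-1 * e by rewrite ler_wpM2r// ltW.
    by lra.
  (* The lag [2 * D] costs at most a factor 2, so the error term removes at most
     [2 * e * u * a t]. *)
  have lo : (1 - 3 * e) * u * a t <= a t - a t.+1.
    apply: le_trans h4.
    have : (1 - 4 * e) * a (t - 2 * D)%N <= a t.
      apply: le_trans h2; rewrite ler_wpM2r// natrM; lra.
    move=> h; have h5 : a (t - 2 * D)%N <= 2 * a t by nra.
    have : e * u * a (t - 2 * D)%N <= e * u * (2 * a t).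
      by rewrite ler_wpM2l// mulr_ge0 ?ltW.
    by lra.
  have -> : - ln (a t.+1) - - ln (a t) = - ln (a t.+1 / a t).
    by rewrite ln_div ?posrE//; lra.
  have r0 : 0 < a t.+1 / a t by rewrite divr_gt0.
  have r1 : a t.+1 / a t <= 1 - (1 - 3 * e) * u.
    by rewrite ler_pdivrMr//; lra.
  have r2 : 1 - (1 + 4 * e) * u <= a t.+1 / a t.
    by rewrite ler_pdivlMr//; lra.
  apply/andP; split.
    rewrite lerNr; apply: le_trans (ln1B_le u2).
    by rewrite ler_ln ?posrE//; lra.
  rewrite lerNl; apply: le_trans (ln1B_ge u1) _.
  by rewrite ler_ln ?posrE//; lra.
(* The slack given to [linear_growth] is proportional to [u], to keep the final bounds relative to
   [u]. *)
have eu : 0 < e * u by rewrite mulr_gt0.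
have [N _ HN] := linear_growth inc eu.
exists N => // t /HN /andP[h1 h2]; apply/andP; split; first by nra.
apply: le_trans h2 _.
suff : (1 + 4 * e) * u / (1 - (1 + 4 * e) * u) <= (1 + 10 * e) * u by nra.
rewrite ler_pdivrMr; last by lra.
rewrite mulrAC ler_wpM2r ?(ltW u0)//.
have : (1 + 4 * e) * u <= (1 + 4 * e) * e by rewrite ler_wpM2l//; lra.
nra.
Qed.

End real_sequences.

Section eventual_bounds.
Context {R : realType}.
Local Open Scope ereal_scope.
Implicit Types (v : nat -> \bar R) (x : \bar R).

Lemma limn_esup_le_near v x : (\forall n \near \oo, v n <= x) ->
  limn_esup v <= x.
Proof.
move=> H; apply: (@le_trans _ _ (ereal_sup (v @` [set n | v n <= x]))).
  by apply: ereal_inf_lbound; exists [set n | v n <= x].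
by apply: ge_ereal_sup => _ [n /= vn <-].
Qed.

Lemma limn_einf_ge_near v x : (\forall n \near \oo, x <= v n) ->
  x <= limn_einf v.
Proof.
move=> H; rewrite /limn_einf leeNr; apply: limn_esup_le_near.
by apply: filterS H => n; rewrite leeN2.
Qed.

Lemma ratio_cvg1 (y : nat -> \bar R) (w : nat -> \bar R) :
  (forall n, 0 < w n) -> (forall n, w n \is a fin_num) ->
  (forall e : R, (0 < e)%R -> \forall n \near \oo,
     (1 - e)%:E * w n <= y n /\ y n <= (1 + e)%:E * w n) ->
  y n / w n @[n --> \oo] --> 1.
Proof.
move=> w0 wfin H.
have K (e : R) : (0 < e)%R -> \forall n \near \oo,
    (1 - e)%:E <= y n / w n /\ y n / w n <= (1 + e)%:E.
  move=> /H; apply: filterS => n.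
  have -> : w n = (fine (w n))%:E by rewrite fineK.
  have := w0 n; rewrite -{1}(fineK (wfin n)) lte_fin => wn0 [h1 h2].
  rewrite inver gt_eqF// lee_pdivlMr// lee_pdivrMr//.
apply/fine_cvgP; split.
  have /K := @ltr01 R; apply: filterS => n [h1 h2].
  by rewrite fin_numE -ltNye -ltey (lt_le_trans _ h1) ?(le_lt_trans h2) ?ltNyr ?ltry.
apply/cvgrPdist_le => e e0; have := K _ e0; apply: filterS => n /= [h1 h2].
have f : y n / w n \is a fin_num.
  by rewrite fin_numE -ltNye -ltey (lt_le_trans _ h1) ?(le_lt_trans h2) ?ltNyr ?ltry.
rewrite -(fineK f) !lee_fin in h1 h2.
by rewrite distrC ler_distlC; apply/andP; split; lra.
Qed.

End eventual_bounds.

Section survivors.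
Context {d : measure_display} {X : measurableType d} {R : realType}.
Variables (mu : probability X R) (T : X -> X).
Implicit Types (U : set X) (t : nat).

Definition survivors U t : set X :=
  [set x | forall j, (j < t)%N -> ~ U (iter j T x)].

(** Entry times count from time 1 and survivors from time 0; the preimage makes up for this shift,
    and invariance then makes it harmless. *)
Lemma entry_time_gt U t :
  [set x | ((t%:R : R)%:E < entry_time T U x)%E] = T @^-1` survivors U t.
Proof.
apply/seteqP; split => x /=.
  move=> tx j jt Uj.
  have : (entry_time T U x <= (j.+1%:R : R)%:E)%E.
    apply: ereal_inf_lbound; exists j.+1 => //=; split => //.
    by rewrite -iterS iterSr.
  move=> /(lt_le_trans tx); rewrite lte_fin ltr_nat; lia.
move=> H; apply: (@lt_le_trans _ _ (t.+1%:R%:E)%E).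
  by rewrite lte_fin ltr_nat.
apply: le_ereal_inf_tmp => _ [j /= [j1 Uj] <-].
rewrite lee_fin ler_nat ltnNge; apply/negP => jt.
apply: (H j.-1); first by lia.
by rewrite -iterSr prednK.
Qed.

Lemma survivors0 U : survivors U 0 = setT.
Proof. by apply/seteqP; split. Qed.

Lemma survivorsS U t : survivors U t.+1 = ~` U `&` T @^-1` survivors U t.
Proof.
apply/seteqP; split => x /=.
  move=> H; split; first exact: (H 0%N).
  by move=> j jt; have := H j.+1 jt; rewrite iterSr.
move=> [nU H] [|j] jt //=.
by rewrite -iterS iterSr; exact: H.
Qed.

Lemma survivors_sub U j r t : (j + r <= t)%N ->
  survivors U t `<=` iter j T @^-1` survivors U r.
Proof.
move=> jrt x /= H i ir; rewrite -iterD; apply: H; lia.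
Qed.

Lemma measurable_survivors U t : measurable_fun [set: X] T -> measurable U ->
  measurable (survivors U t).
Proof.
move=> mT mU; elim: t => [|t IH]; first by rewrite survivors0.
rewrite survivorsS; apply: measurableI; first exact: measurableC.
by rewrite -[X in measurable X]setTI; exact: mT.
Qed.

(** Positivity keeps [lne] away from its value [-oo] at 0; as probabilities are at most 1, the
    absolute value is a change of sign. *)
Lemma escape_rate_bounds U (l L : R) :
  measure_preserving mu T -> measurable U ->
  (forall t, 0 < fine (mu (survivors U t))) ->
  (\forall t \near \oo,
     l <= t%:R^-1 * - ln (fine (mu (survivors U t))) <= L) ->
  (l%:E <= lower_escape_rate mu T U)%E /\
  (upper_escape_rate mu T U <= L%:E)%E.
Proof.
move=> [mT muT] mU pos H.
have E t : (0 < t)%N -> escape_seq mu T U t =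
    (t%:R^-1 * - ln (fine (mu (survivors U t))))%:E.
  move=> t0; rewrite /escape_seq entry_time_gt muT; last exact: measurable_survivors.
  set m := mu _.
  have mf : m \is a fin_num by apply: fin_num_measure; exact: measurable_survivors.
  have -> : m = (fine m)%:E by rewrite fineK.
  rewrite lne_EFin; last exact: pos.
  rewrite /= EFinM; congr (_ * _%:E)%E; rewrite ler0_norm//.
  apply: ln_le0; rewrite -lee_fin fineK//; apply: probability_le1.
  exact: measurable_survivors.
have H' : \forall t \near \oo, (l%:E <= escape_seq mu T U t)%E /\
    (escape_seq mu T U t <= L%:E)%E.
  near=> t; rewrite E; last by near: t; exists 1%N.
  by rewrite !lee_fin; apply/andP; near: t.
split.
  by apply: limn_einf_ge_near; apply: filterS H' => t [].
by apply: limn_esup_le_near; apply: filterS H' => t [].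
Unshelve. all: by end_near. Qed.

(** The lower rate never exceeds the upper one, so a single bound on each squeezes both; when the
    sequence converges its limit is the lower limit. *)
Lemma localized_escape_rates (U : nat -> set X) :
  (forall n, 0 < mu (U n))%E -> (forall n, measurable (U n)) ->
  (forall e : R, 0 < e -> \forall n \near \oo,
     ((1 - e)%:E * mu (U n) <= lower_escape_rate mu T (U n))%E /\
     (upper_escape_rate mu T (U n) <= (1 + e)%:E * mu (U n))%E) ->
  [/\ (lower_escape_rate mu T (U n) / mu (U n))%E @[n --> \oo] --> 1%E,
      (upper_escape_rate mu T (U n) / mu (U n))%E @[n --> \oo] --> 1%E &
      (\forall n \near \oo, cvgn (escape_seq mu T (U n))) ->
        (escape_rate mu T (U n) / mu (U n))%E @[n --> \oo] --> 1%E].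
Proof.
move=> U0 mU H.
have Ufin n : mu (U n) \is a fin_num by exact: fin_num_measure.
have lu n : (lower_escape_rate mu T (U n) <= upper_escape_rate mu T (U n))%E.
  exact: limn_einf_sup.
have L1 : (lower_escape_rate mu T (U n) / mu (U n))%E @[n --> \oo] --> 1%E.
  apply: ratio_cvg1 => // e /H; apply: filterS => n [h1 h2]; split => //.
  exact: le_trans h2.
split => //.
  apply: ratio_cvg1 => // e /H; apply: filterS => n [h1 h2]; split => //.
  exact: le_trans (lu n).
move=> C; apply: cvg_trans L1; apply: near_eq_cvg.
apply: filterS C => n Cn; congr (_ / _)%E.
by rewrite /lower_escape_rate is_cvg_limn_einfE.
Qed.

End survivors.

(** * Saturated sets and cylinders *)

Section real_probability.
Context {d : measure_display} {X : measurableType d} {R : realType}.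
Variable mu : probability X R.
Local Notation Pr A := (fine (mu A)).
Implicit Types A B : set X.

Lemma prE A : measurable A -> mu A = (Pr A)%:E.
Proof. by move=> mA; rewrite fineK// fin_num_measure. Qed.

Lemma pr_ge0 A : 0 <= Pr A.
Proof. by rewrite fine_ge0. Qed.

Lemma pr_le A B : measurable A -> measurable B -> A `<=` B -> Pr A <= Pr B.
Proof.
move=> mA mB AB; rewrite fine_le ?fin_num_measure//.
by rewrite le_measure ?inE.
Qed.

Lemma prT : Pr [set: X] = 1.
Proof. by rewrite probability_setT. Qed.

Lemma pr0 : Pr (set0 : set X) = 0.
Proof. by rewrite measure0. Qed.

Lemma pr_le1 A : measurable A -> Pr A <= 1.
Proof. by move=> mA; rewrite -prT pr_le. Qed.

Lemma pr_split A B : measurable A -> measurable B ->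
  Pr A = Pr (A `&` B) + Pr (A `&` ~` B).
Proof.
move=> mA mB; rewrite -fineD ?fin_num_measure//; last 2 first.
  exact: measurableI.
  by apply: measurableI => //; exact: measurableC.
rewrite -measureU//; last 3 first.
  exact: measurableI.
  by apply: measurableI => //; exact: measurableC.
  by rewrite setIACA setICr setI0.
by rewrite -setIUr setUv setIT.
Qed.

Lemma prC A : measurable A -> Pr (~` A) = 1 - Pr A.
Proof.
by move=> mA; have := @pr_split setT A measurableT mA; rewrite prT !setTI; lra.
Qed.

Lemma pr_setU_le A B : measurable A -> measurable B ->
  Pr (A `|` B) <= Pr A + Pr B.
Proof.
move=> mA mB; rewrite -lee_fin EFinD -!prE//; last exact: measurableU.
exact: measureU2.
Qed.

Lemma pr_bigsetU_le (F : nat -> set X) m n :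
  (forall j, measurable (F j)) ->
  Pr (\big[setU/set0]_(m <= j < n) F j) <= \sum_(m <= j < n) Pr (F j).
Proof.
move=> mF.
have mB p q : measurable (\big[setU/set0]_(p <= j < q) F j).
  by apply: bigsetU_measurable.
elim: n => [|n IH]; first by rewrite !big_geq// pr0.
have [mn|nm] := leqP m n; last by rewrite !big_geq// pr0.
rewrite !big_nat_recr//=; apply: le_trans (pr_setU_le (mB _ _) (mF _)) _.
by rewrite lerD2r.
Qed.

(** This carries an inequality proved on single cylinders over to countable unions of them. *)
Lemma pr_le_series A (E : nat -> set X) (B1 B2 : set X) (c1 c2 : R) :
  (forall k, measurable (E k)) -> trivIset [set: nat] E ->
  A = \bigcup_k E k -> measurable B1 -> measurable B2 ->
  0 <= c1 -> 0 <= c2 ->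
  (forall k, c1 * Pr (E k `&` B1) <= c2 * Pr (E k `&` B2)) ->
  c1 * Pr (A `&` B1) <= c2 * Pr (A `&` B2).
Proof.
move=> mE tE AE mB1 mB2 c10 c20 H.
have mA : measurable A by rewrite AE; exact: bigcupT_measurable.
have S B : measurable B -> mu (A `&` B) = (\sum_(k <oo) mu (E k `&` B))%E.
  move=> mB; rewrite AE setI_bigcupl measure_semi_bigcup//.
  - by move=> k; exact: measurableI.
  - exact: trivIset_setIr.
  - by apply: bigcupT_measurable => k; exact: measurableI.
rewrite -lee_fin !EFinM -!prE; do ?exact: measurableI.
rewrite !S// -!nneseriesZl//.
apply: lee_nneseries => [k _ _|k _]; first by rewrite mule_ge0.
rewrite (prE (measurableI _ _ (mE k) mB1)) (prE (measurableI _ _ (mE k) mB2)).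
by rewrite -!EFinM lee_fin.
Qed.

End real_probability.

Section itineraries.
Context {d : measure_display} {X : measurableType d}.
Variables (T : X -> X) (P : set (set X)).
Implicit Types (n m : nat) (x y : X) (A : set X).

(** The one-sided implication makes reflexivity and transitivity immediate. Symmetry holds as soon
    as [P] is a partition, because each point then lies in exactly one element. *)
Definition same_itinerary n x y :=
  forall j A, (j < n)%N -> P A -> A (iter j T x) -> A (iter j T y).

(* For a partition [P], the unions of [n]-cylinders. *)
Definition saturated n A := forall x y, same_itinerary n x y -> A x -> A y.

Definition cyl n x : set X := [set y | same_itinerary n x y].

Lemma itin_le m n x y : (m <= n)%N ->
  same_itinerary n x y -> same_itinerary m x y.
Proof. by move=> mn H j A jm; apply: H; exact: leq_trans mn. Qed.

Lemma itin_refl n x : same_itinerary n x x. Proof. by []. Qed.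

Lemma itin_trans n x y z :
  same_itinerary n x y -> same_itinerary n y z -> same_itinerary n x z.
Proof. by move=> h1 h2 j A jn PA Ax; apply: h2 => //; exact: h1. Qed.

Lemma itin_shift n m x y : same_itinerary (n + m) x y ->
  same_itinerary m (iter n T x) (iter n T y).
Proof.
by move=> H j A jm PA; rewrite -!iterD; apply: H => //; rewrite addnC ltn_add2l.
Qed.

Lemma itin_glue n m x y : same_itinerary n x y ->
  same_itinerary m (iter n T x) (iter n T y) -> same_itinerary (n + m) x y.
Proof.
move=> h1 h2 j A jnm PA; have [jn|nj] := ltnP j n; first exact: h1.
have -> : j = ((j - n) + n)%N by rewrite subnK.
by rewrite !iterD; apply: h2 => //; lia.
Qed.

Lemma saturated_le m n A : (m <= n)%N -> saturated m A -> saturated n A.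
Proof. by move=> mn H x y xy; apply: H; exact: itin_le xy. Qed.

Lemma saturatedI n A B : saturated n A -> saturated n B -> saturated n (A `&` B).
Proof. by move=> h1 h2 x y xy [Ax Bx]; split; [exact: h1 Ax|exact: h2 Bx]. Qed.

Lemma saturated_bigcup n I (D : set I) (F : I -> set X) :
  (forall i, D i -> saturated n (F i)) -> saturated n (\bigcup_(i in D) F i).
Proof. by move=> h x y xy [i Di Fi]; exists i => //; exact: h Fi. Qed.

Lemma saturated_preimage n m A : saturated m A ->
  saturated (n + m) (iter n T @^-1` A).
Proof. by move=> h x y /itin_shift; exact: h. Qed.

Lemma saturated_cyl n x : saturated n (cyl n x).
Proof. by move=> y z yz xy; exact: itin_trans yz. Qed.

Hypothesis partP : partition P id [set: X].

Lemma partition_ex x : exists2 A, P A & A x.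
Proof. by case: partP => cP _ _; have : [set: X] x by []; rewrite -cP. Qed.

Lemma partition_eq A B x : P A -> P B -> A x -> B x -> A = B.
Proof. by case: partP => _ tP _ PA PB Ax Bx; apply: tP => //; exists x. Qed.

Lemma itin_sym n x y : same_itinerary n x y -> same_itinerary n y x.
Proof.
move=> H j A jn PA Ay; have [B PB Bx] := partition_ex (iter j T x).
by rewrite (partition_eq PA PB Ay (H j B jn PB Bx)).
Qed.

Lemma saturatedC n A : saturated n A -> saturated n (~` A).
Proof. by move=> h x y xy nAx Ay; apply: nAx; apply: h Ay; exact: itin_sym. Qed.

Lemma cyl_eq n x y : same_itinerary n x y -> cyl n x = cyl n y.
Proof.
move=> xy; apply/seteqP; split => z /=; last exact: itin_trans.
by apply: itin_trans; exact: itin_sym.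
Qed.

Lemma cyl0 x : cyl 0 x = setT.
Proof. by apply/seteqP; split. Qed.

Lemma cyl1 A x : P A -> A x -> cyl 1 x = A.
Proof.
move=> PA Ax; apply/seteqP; split => y /=; first by move/(_ 0%N A); exact.
by move=> Ay [|//] B _ PB /= Bx; rewrite (partition_eq PB PA Bx Ax).
Qed.

Lemma saturated_survivors k U t : saturated k U ->
  saturated (k + t) (survivors T U t).
Proof.
move=> kU x y xy H j jt Uy; apply: (H j jt).
apply: saturated_preimage kU _ _ _ Uy; apply: itin_sym.
by apply: itin_le xy; lia.
Qed.

Lemma cylindersP n Z : cylinders T P n Z <-> exists x, Z = cyl n x.
Proof.
split => [[[x Zx] [a Pa ZE]]|[x ->]].
  exists x; apply/seteqP; split => y.
    rewrite ZE => Zy j A jn PA Ax.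
    move: Zx; rewrite ZE => /(_ j jn) /= aj.
    by rewrite (partition_eq PA (Pa j jn) Ax aj); exact: Zy.
  rewrite ZE in Zx *; move=> xy j jn /=.
  by apply: xy => //; [exact: Pa|exact: (Zx j jn)].
split; first by exists x; exact: itin_refl.
have /(_ _)/cid2 H j := partition_ex (iter j T x).
exists (fun j => s2val (H j)) => [j _|]; first exact: (s2valP (H j)).
apply/seteqP; split => y /=.
  move=> xy j jn /=; apply: xy => //; first exact: (s2valP (H j)).
  exact: (s2valP' (H j)).
move=> yH j A jn PA Ax.
rewrite (partition_eq PA (s2valP (H j)) Ax (s2valP' (H j))).
exact: yH.
Qed.

Lemma cylinder_atE n x : cylinder_at T P n x = cyl n x.
Proof.
apply/seteqP; split => y /=.
  by move=> [Z [/cylindersP [z ->] zx] zy]; rewrite -(cyl_eq zx).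
move=> xy; exists (cyl n x) => //; split; last exact: itin_refl.
by apply/cylindersP; exists x.
Qed.

Lemma saturated_union n A : union_of (cylinders T P n) A -> saturated n A.
Proof.
move=> [G Gc ->]; apply: saturated_bigcup => Z /Gc /cylindersP[x ->].
exact: saturated_cyl.
Qed.

Lemma saturated_hull n A : saturated n (cylinder_hull T P A n).
Proof.
apply: saturated_bigcup => Z [/cylindersP[x ->] _]; exact: saturated_cyl.
Qed.

Lemma sub_hull n A : A `<=` cylinder_hull T P A n.
Proof.
move=> x Ax; exists (cyl n x); last exact: itin_refl.
split; first by apply/cylindersP; exists x.
by exists x; split => //; exact: itin_refl.
Qed.

Hypothesis countP : countable P.

Lemma cylinder_enum n : exists E : nat -> set X,
  [/\ forall k, E k = set0 \/ exists x, E k = cyl n x,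
      trivIset [set: nat] E & \bigcup_k E k = setT].
Proof.
have /countable_injP[f finj] := countP.
pose code x := pickle [seq f (xget set0 [set A | P A /\ A (iter j T x)]) | j <- iota 0 n].
have codeP x y : code x = code y <-> same_itinerary n x y.
  have G z j : P (xget set0 [set A | P A /\ A (iter j T z)]) /\
      (xget set0 [set A | P A /\ A (iter j T z)]) (iter j T z).
    apply: (@xgetPex _ set0 [set A | P A /\ A (iter j T z)]).
    by have [A PA Az] := partition_ex (iter j T z); exists A.
  split.
    move=> /(pcan_inj pickleK) /eq_in_map H j A jn PA Ax.
    have /H : j \in iota 0 n by rewrite mem_iota.
    move=> /finj; rewrite !inE => /(_ (G x j).1 (G y j).1) E.
    rewrite (partition_eq PA (G x j).1 Ax (G x j).2) E.
    exact: (G y j).2.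
  move=> xy; rewrite /code; congr pickle; apply/eq_in_map => j.
  rewrite mem_iota /= add0n => jn; congr f.
  apply: (partition_eq (G x j).1 (G y j).1 _ (G y j).2).
  exact: (xy j _ jn (G x j).1 (G x j).2).
exists (fun k => [set x | code x = k]); split.
- move=> k; have [[x xk]|nx] := pselect (exists x, code x = k); [right|left].
    exists x; apply/seteqP; split => y /=; rewrite -xk.
      by move=> yx; apply/codeP.
    by move/codeP.
  by apply/seteqP; split => // x xk; apply: nx; exists x.
- by move=> i j _ _ [x [/= <- <-]].
- by apply/seteqP; split => // x _; exists (code x).
Qed.

Lemma saturated_enum n A : saturated n A -> exists E : nat -> set X,
  [/\ forall k, E k = set0 \/ exists2 x, E k = cyl n x & A x,
      trivIset [set: nat] E & A = \bigcup_k E k].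
Proof.
move=> nA; have [E [E1 E2 E3]] := cylinder_enum n.
exists (fun k => E k `&` A); split.
- move=> k; have [->|[x ->]] := E1 k; first by left; rewrite set0I.
  have [Ax|nAx] := pselect (A x); [right; exists x => //|left].
    by apply/seteqP; split => y; [case|move=> xy; split => //; exact: nA Ax].
  apply/seteqP; split => // y [xy Ay]; apply: nAx; apply: nA Ay.
  exact: itin_sym.
- exact: trivIset_setIr.
- by rewrite -setI_bigcupl E3 setTI.
Qed.

Lemma saturated_sigma n A : saturated n A -> <<s cylinders T P n >> A.
Proof.
move=> /saturated_enum[E [E1 _ ->]].
apply: sigma_algebra_bigcup => k; have [->|[x -> _]] := E1 k.
  exact: sigma_algebra0.
by apply: sub_sigma_algebra; apply/cylindersP; exists x.
Qed.

Lemma saturated_sigma_bigcup n A : saturated n A ->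
  <<s \bigcup_(j in [set: nat]) cylinders T P j >> A.
Proof.
move=> /saturated_sigma; apply: sub_smallest2r.
  exact: smallest_sigma_algebra.
by move=> Z cZ; exists n.
Qed.

Hypothesis mP : forall A, P A -> measurable A.
Hypothesis mT : measurable_fun [set: X] T.

Lemma measurable_iter n : measurable_fun [set: X] (iter n T).
Proof.
elim: n => [|n IH]; first exact: measurable_id.
exact: measurableT_comp.
Qed.

Lemma measurable_pre n A : measurable A -> measurable (iter n T @^-1` A).
Proof.
by move=> mA; rewrite -[X in measurable X]setTI; exact: measurable_iter.
Qed.

Lemma measurable_saturated n A : saturated n A -> measurable A.
Proof.
move=> /saturated_enum[E [E1 _ ->]].
apply: bigcupT_measurable => k; have [->|[x -> _]] := E1 k => //.
have : cylinders T P n (cyl n x) by apply/cylindersP; exists x.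
move=> [_ [a Pa ->]].
by apply: bigcap_measurableType => j jn; apply: measurable_pre; apply: mP; exact: Pa.
Qed.

End itineraries.

Section recursion.
Context {d : measure_display} {X : measurableType d} {R : realType}.
Variables (mu : probability X R) (T : X -> X).
Hypothesis muT : measure_preserving mu T.
Local Notation Pr A := (fine (mu A)).
Implicit Types (U A B : set X) (t : nat).

Let mT : measurable_fun [set: X] T. Proof. by case: muT. Qed.

Lemma pr_pre n A : measurable A -> Pr (iter n T @^-1` A) = Pr A.
Proof.
move=> mA; elim: n => [//|n <-]; case: muT => _ mu_pre.
rewrite -[RHS](congr1 fine (mu_pre _ (measurable_pre mT n mA))).
by congr (Pr _); apply/seteqP; split => x /=; rewrite -iterSr.
Qed.

Lemma survivors_step U t : measurable U ->
  Pr (survivors T U t) - Pr (survivors T U t.+1) =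
  Pr (U `&` iter 1 T @^-1` survivors T U t).
Proof.
move=> mU; have mS := measurable_survivors t mT mU.
rewrite survivorsS -(pr_pre 1 mS).
rewrite (pr_split mu (measurable_pre mT 1 mS) mU).
by rewrite (setIC U) (setIC (~` U)); exact: addrK.
Qed.

(** Independence is required only on average over the gaps [c + k], all below [D]. In the sum over
    returns the survival starts at the fixed time [D.*2.+1], whatever the return time [j <= D], so
    more than [D] steps remain after the return for a second decoupling. *)
Lemma escape_rate_of_mixing U (e : R) (c N : nat) (u := Pr U)
    (a := fun t => Pr (survivors T U t)) :
  measurable U -> 0 < u -> 0 < e <= 20^-1 -> (0 < c)%N -> (0 < N)%N ->
  (c + N)%:R * u <= e ->
  (forall r, `|\sum_(0 <= k < N) Pr (U `&` iter (c + k) T @^-1` survivors T U r)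
     - N%:R * (u * a r)| <= e * (N%:R * (u * a r))) ->
  (forall r, \sum_(1 <= j < (c + N).+1)
     Pr (U `&` iter j T @^-1` (U `&`
       iter ((c + N).*2.+1 - j) T @^-1` survivors T U r)) <= e * (u * a r)) ->
  ((1 - 20 * e)%:E * mu U <= lower_escape_rate mu T U)%E /\
  (upper_escape_rate mu T U <= (1 + 20 * e)%:E * mu U)%E.
Proof.
move=> mU u0 e01 c0 N0 cNu avg short.
set D := (c + N)%N in cNu short *.
have mS t : measurable (survivors T U t) by exact: measurable_survivors.
have mp n A : measurable A -> measurable (iter n T @^-1` A).
  by move=> mA; exact: measurable_pre.
have NR : 0 < N%:R :> R by rewrite ltr0n.
have a_ge0 t : 0 <= a t by exact: pr_ge0.
have dE t : a t - a t.+1 = Pr (U `&` iter 1 T @^-1` survivors T U t).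
  exact: survivors_step.
have [a0 rate] : (forall t, 0 < a t) /\ \forall t \near \oo,
    (1 - 20 * e) * u <= t%:R^-1 * - ln (a t) <= (1 + 20 * e) * u.
  apply: (@survival_rate _ a u e D) => //.
  - by rewrite /a survivors0 prT.
  - move=> t; rewrite dE; apply: pr_le => //.
    by apply: measurableI => //; exact: mp.
  (* Each gap [c + k] is less than [D], so surviving [t] steps from time 1 implies surviving [t - D]
     steps from time [c + k]; the average over [k] costs nothing. *)
  - move=> t Dt.
    have H k : (k < N)%N -> a t - a t.+1 <=
        Pr (U `&` iter (c + k) T @^-1` survivors T U (t - D)).
      move=> kN; rewrite dE; apply: pr_le.
      + by apply: measurableI => //; exact: mp.
      + by apply: measurableI => //; exact: mp.
      move=> x [Ux Sx]; split => //=.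
      have -> : (c + k = (c + k).-1 + 1)%N by lia.
      by rewrite iterD; apply: survivors_sub Sx; rewrite /D; lia.
    have S : N%:R * (a t - a t.+1) <= \sum_(0 <= k < N)
        Pr (U `&` iter (c + k) T @^-1` survivors T U (t - D)).
      rewrite mulr_natl -[X in _ *+ X]subn0 -sumr_const_nat.
      by rewrite big_nat [leRHS]big_nat; apply: ler_sum => k /andP[_ /H].
    have := avg (t - D)%N; rewrite ler_norml => /andP[_].
    rewrite lerBlDr => /(le_trans S) S2.
    rewrite -(ler_pM2l NR); apply: le_trans S2 _.
    by rewrite le_eqVlt; apply/orP; left; apply/eqP; ring.
  (* A point of [U] that survives from time [c + k] on but not from time 1 returns to [U] inside the
     gap; it also avoids [U] for [t - 2 * D] steps from time [D.*2.+1], and so is counted in [S]. *)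
  - move=> t Dt.
    set S := \sum_(1 <= j < D.+1)
      Pr (U `&` iter j T @^-1` (U `&`
       iter (D.*2.+1 - j) T @^-1` survivors T U (t - 2 * D))).
    have H k : (k < N)%N -> Pr (U `&` iter (c + k) T @^-1` survivors T U t) <=
        a t - a t.+1 + S.
      move=> kN; rewrite dE.
      pose F j := U `&` iter j T @^-1` (U `&`
        iter (D.*2.+1 - j) T @^-1` survivors T U (t - 2 * D)).
      have mF j : measurable (F j).
        by apply: measurableI => //; apply: (mp); apply: measurableI => //; exact: mp.
      have mW : measurable (U `&` iter 1 T @^-1` survivors T U t).
        by apply: measurableI => //; exact: mp.
      have mB : measurable (\big[setU/set0]_(1 <= j < D.+1) F j).
        by apply: bigsetU_measurable.
      apply: (@le_trans _ _ (Pr ((U `&` iter 1 T @^-1` survivors T U t) `|`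
          \big[setU/set0]_(1 <= j < D.+1) F j))); last first.
        apply: le_trans (pr_setU_le mu mW mB) _.
        by rewrite lerD2l; exact: pr_bigsetU_le.
      apply: pr_le; [|exact: measurableU|].
        by apply: measurableI => //; exact: mp.
      move=> x [Ux Sx].
      have [Hx|] := pselect (survivors T U t (iter 1 T x)); [by left|].
      move=> /existsNP[j /not_implyP[jt /contrapT Uj]]; right.
      rewrite -iterD addn1 in Uj.
      have hit i : (c + k <= i < c + k + t)%N -> ~ U (iter i T x).
        move=> ick; have := Sx (i - (c + k))%N; rewrite /= -iterD subnK; last lia.
        by apply; lia.
      have jck : (j.+1 < c + k)%N.
        by rewrite ltnNge; apply/negP => ckj; apply: (hit j.+1) => //; lia.
      rewrite -bigcup_seq; exists j.+1.
        by rewrite /= mem_index_iota /D; lia.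
      split; [exact: Ux|split; [exact: Uj|]] => i it.
      change (~ U (iter i T (iter (D.*2.+1 - j.+1) T (iter j.+1 T x)))).
      by rewrite -!iterD; apply: hit; rewrite /D in it *; lia.
    have SN : \sum_(0 <= k < N) Pr (U `&` iter (c + k) T @^-1` survivors T U t)
        <= N%:R * (a t - a t.+1 + S).
      rewrite mulr_natl -[X in _ *+ X]subn0 -sumr_const_nat.
      by rewrite big_nat [leRHS]big_nat; apply: ler_sum => k /andP[_ /H].
    have := avg t; rewrite ler_norml => /andP[+ _].
    rewrite lerBrDr => /le_trans/(_ SN) S2.
    have S3 : (1 - e) * u * a t <= a t - a t.+1 + S.
      rewrite -(ler_pM2l NR); apply: le_trans S2.
      by rewrite le_eqVlt; apply/orP; left; apply/eqP; ring.
    have := short (t - 2 * D)%N; rewrite -/S; lra.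
  - by rewrite /D addn_gt0 c0.
have muU : mu U = u%:E by exact: prE.
rewrite muU -!EFinM; exact: escape_rate_bounds.
Qed.

End recursion.

Section powR_tails.
Context {R : realType}.
Implicit Types (p q e x y : R).

Lemma powRN_le p x y : 0 <= p -> 0 < x -> x <= y -> y `^ (- p) <= x `^ (- p).
Proof.
move=> p0 x0 xy; have y0 := lt_le_trans x0 xy.
rewrite !powRN lef_pV2 ?posrE ?powR_gt0//.
by apply: ge0_ler_powR => //; rewrite nnegrE ltW.
Qed.

(** A discrete form of comparison with an integral: dividing by the power of [k.+1] reduces it to
    [1 + q * x <= (1 - x) ^ (- q)] at [x = 1 / k.+1], which follows from [1 + y <= exp y] and
    [ln (1 - x) <= - x]. *)
Lemma powRN_telescope q (k : nat) : 0 < q -> (0 < k)%N ->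
  q * k.+1%:R `^ (- (q + 1)) <= k%:R `^ (- q) - k.+1%:R `^ (- q).
Proof.
move=> q0 k0.
have x0 : 0 < k%:R :> R by rewrite ltr0n.
have y0 : 0 < k.+1%:R :> R by rewrite ltr0n.
have xE : k%:R = k.+1%:R * (1 - k.+1%:R^-1) :> R.
  by rewrite mulrBr mulr1 mulfV ?lt0r_neq0// -natr1 addrK.
have z1 : k.+1%:R^-1 < 1 :> R by rewrite invf_lt1// ltr1n.
have z0 : 0 < 1 - k.+1%:R^-1 :> R by rewrite subr_gt0.
have h : 1 + q * k.+1%:R^-1 <= (1 - k.+1%:R^-1) `^ (- q) :> R.
  rewrite /powR gt_eqF//; apply: le_trans (expR_ge1Dx _).
  rewrite lerD2l mulNr -mulrN ler_pM2l// lerNr.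
  exact: ln1B_le.
have -> : k%:R `^ (- q) = k.+1%:R `^ (- q) * (1 - k.+1%:R^-1) `^ (- q) :> R.
  by rewrite -powRM ?(ltW z0)// -xE.
have -> : k.+1%:R `^ (- (q + 1)) = k.+1%:R `^ (- q) * k.+1%:R^-1 :> R.
  by rewrite opprD powRD ?powR_inv1// ?lt0r_neq0// implybT.
rewrite -[X in _ - X]mulr1 -mulrBr mulrCA ler_wpM2l ?powR_ge0//.
by rewrite lerBrDl.
Qed.

Lemma powRN_cvg0 q e : 0 < q -> 0 < e -> exists2 J : nat, (0 < J)%N &
  forall k : nat, (J <= k)%N -> k%:R `^ (- q) <= e.
Proof.
move=> q0 e0; have e10 : 0 < e^-1 `^ q^-1 by rewrite powR_gt0 ?invr_gt0.
exists (Num.truncn (e^-1 `^ q^-1)).+1 => // k Jk.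
have h : e^-1 `^ q^-1 <= k%:R.
  apply: le_trans (_ : (Num.truncn (e^-1 `^ q^-1)).+1%:R <= _); last by rewrite ler_nat.
  by rewrite ltW// truncnS_gt.
apply: le_trans (powRN_le (ltW q0) e10 h) _.
by rewrite -powRrM mulrN mulVf ?gt_eqF// powR_inv1 ?invr_ge0 ?(ltW e0)// invrK.
Qed.

Lemma powRN_tail p e : 1 < p -> 0 < e -> exists J : nat, forall n,
  \sum_(J <= j < n) j%:R `^ (- p) <= e.
Proof.
move=> p1 e0; have q0 : 0 < p - 1 by rewrite subr_gt0.
have [J J0 HJ] := powRN_cvg0 q0 (mulr_gt0 q0 e0).
have T n : (p - 1) * \sum_(J.+1 <= j < J.+1 + n) j%:R `^ (- p) <=
    J%:R `^ (- (p - 1)) - (J + n)%:R `^ (- (p - 1)).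
  elim: n => [|n IH]; first by rewrite !addn0 big_geq// mulr0 subrr.
  rewrite addnS big_nat_recr ?leq_addr//= mulrDr.
  have := @powRN_telescope (p - 1) (J + n) q0 ltac:(lia).
  by rewrite subrK addSn addnS => h; lra.
exists J.+1 => n; have [Jn|nJ] := leqP J.+1 n; last by rewrite big_geq ?(ltW e0)// ltnW.
have := T (n - J.+1)%N; rewrite subnKC// => h.
rewrite -(ler_pM2l q0); apply: le_trans h _.
have := HJ J (leqnn _); have := powR_ge0 (J + (n - J.+1))%:R (- (p - 1)); lra.
Qed.

(** For [j > 2] the rounded half of [j] is at least [j / 3], whence the constant [3 ^ p]. *)
Lemma powRN_half p (j : nat) : 0 <= p -> (2 < j)%N ->
  j./2%:R `^ (- p) <= 3 `^ p * j%:R `^ (- p).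
Proof.
move=> p0 j2; have j0 : 0 < j%:R :> R by rewrite ltr0n; lia.
have -> : 3 `^ p * j%:R `^ (- p) = (j%:R / 3) `^ (- p) :> R.
  by rewrite powRM ?invr_ge0// mulrC -powR_inv1// -powRrM mulrN mulN1r opprK.
apply: powRN_le => //; first by rewrite divr_gt0.
rewrite ler_pdivrMr// -natrM ler_nat; lia.
Qed.

End powR_tails.

(** * Quasi-independence *)

Section quasi_independence.
Context {d : measure_display} {X : measurableType d} {R : realType}.
Variables (mu : probability X R) (T : X -> X) (P : set (set X)).
Hypothesis muT : measure_preserving mu T.
Hypothesis mP : measurable_partition P.
Local Notation Pr A := (fine (mu A)).
Implicit Types (V A B : set X) (i j k m n r q c N D : nat).

Let mT : measurable_fun [set: X] T. Proof. by case: muT. Qed.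
Let partP : partition P id [set: X]. Proof. by case: mP. Qed.

Lemma measurable_sat n A : saturated T P n A -> measurable A.
Proof. by case: mP => cP mP' pP; exact: measurable_saturated. Qed.

(** A one-sided bound that covers both assumptions: right phi-mixing gives [K = 1] and [psi = phi],
    the Gibbs-Markov property a larger [K] and [psi = 0]. *)
Definition quasi_independent (K : R) (psi : nat -> R) :=
  forall i j m A B, saturated T P i A -> saturated T P m B -> (i <= j)%N ->
    Pr (A `&` iter j T @^-1` B) <= (K * Pr A + psi (j - i)%N) * Pr B.

(** A return at time [j] is cut at [j./2]: the first visit is enlarged to its hull of that depth,
    which leaves a gap of at least [j./2] before the second visit. The hull condition and [psi]
    contribute terms summable in [j], and [Pr V] occurs at most [D] times. The last factor comes
    from the second visit and the later survival, which are still more than [D] apart. *)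
Lemma short_returns_le V k (K K2 C C2 p p2 t1 t2 : R) (psi : nat -> R) J c D :
  saturated T P k V -> quasi_independent K psi ->
  0 <= K -> 0 <= C -> 0 <= C2 -> 0 <= p -> 0 <= p2 -> 0 <= K2 ->
  (forall i, (0 < i)%N -> psi i <= C2 * i%:R `^ (- p2)) ->
  (forall j, (0 < j < k)%N ->
     Pr (cylinder_hull T P V j) <= Pr V + C * j%:R `^ (- p)) ->
  (forall j, (0 < j < J)%N -> Pr (iter j T @^-1` V `&` V) = 0) ->
  (2 < J)%N ->
  (forall n, \sum_(J <= j < n) j%:R `^ (- p) <= t1) ->
  (forall n, \sum_(J <= j < n) j%:R `^ (- p2) <= t2) ->
  (forall q r, (c <= q)%N -> Pr (V `&` iter q T @^-1` survivors T V r) <=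
     K2 * (Pr V * Pr (survivors T V r))) ->
  (c <= D)%N ->
  forall r, \sum_(1 <= j < D.+1) Pr (V `&` iter j T @^-1` (V `&`
       iter (D.*2.+1 - j) T @^-1` survivors T V r)) <=
    (K * (D%:R * Pr V + C * 3 `^ p * t1) + C2 * 3 `^ p2 * t2) *
      (K2 * (Pr V * Pr (survivors T V r))).
Proof.
move=> kV QI K0 C0 C20 p0 p20 K20 psile hull per J2 T1 T2 KV cD r.
have mV := measurable_sat kV.
have mS := measurable_survivors r mT mV.
set w := K2 * _; have w0 : 0 <= w by rewrite !mulr_ge0// pr_ge0.
set E := fun j => V `&` iter (D.*2.+1 - j) T @^-1` survivors T V r.
have mE j : measurable (E j) by apply: measurableI => //; exact: measurable_pre.
have near_hit j : (0 < j < J)%N -> Pr (V `&` iter j T @^-1` E j) = 0.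
  move=> /per h; apply/eqP; rewrite eq_le pr_ge0 andbT -h.
  apply: pr_le; first by apply: measurableI => //; exact: measurable_pre.
    by apply: measurableI => //; exact: measurable_pre.
  by move=> x [Vx [Vj _]].
pose b j : R := K * (Pr V + C * 3 `^ p * j%:R `^ (- p)) + C2 * 3 `^ p2 * j%:R `^ (- p2).
have far_hit j : (J <= j <= D)%N -> Pr (V `&` iter j T @^-1` E j) <= b j * w.
  move=> /andP[Jj jD].
  have hj : (j./2 <= j)%N by clear; lia.
  have hj2 : (j./2 <= j - j./2)%N by clear; lia.
  have Ew : Pr (E j) <= w by apply: KV; clear - jD cD; lia.
  have satE : saturated T P (k + (D.*2.+1 - j) + (k + r)) (E j).
    apply: saturatedI; first by apply: saturated_le kV; clear; lia.
    apply: (@saturated_le _ _ _ _ (D.*2.+1 - j + (k + r))); first by clear; lia.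
    by apply: saturated_preimage; exact: saturated_survivors.
  have j3 : (2 < j)%N by exact: leq_trans Jj.
  have hp : (0 < j./2)%N by clear - j3; lia.
  have psij i : (j./2 <= i)%N -> psi i <= C2 * 3 `^ p2 * j%:R `^ (- p2).
    move=> ji; have i0 := leq_trans hp ji.
    apply: le_trans (psile i i0) _; rewrite -mulrA ler_wpM2l//.
    apply: le_trans (powRN_half p20 j3); apply: powRN_le => //.
      by rewrite ltr0n.
    by rewrite ler_nat.
  have halfle : C * j./2%:R `^ (- p) <= C * 3 `^ p * j%:R `^ (- p).
    by rewrite -mulrA ler_wpM2l//; exact: powRN_half.
  have step i A : saturated T P i A -> (i <= j./2)%N -> V `<=` A ->
      Pr A <= Pr V + C * 3 `^ p * j%:R `^ (- p) ->
      Pr (V `&` iter j T @^-1` E j) <= b j * w.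
    move=> satA ij VA PA; have mA := measurable_sat satA.
    apply: (@le_trans _ _ (Pr (A `&` iter j T @^-1` E j))).
      apply: pr_le; last by move=> x [Vx Ex]; split => //; exact: VA.
        by apply: measurableI => //; exact: measurable_pre.
      by apply: measurableI => //; exact: measurable_pre.
    have ij' := leq_trans ij hj.
    apply: le_trans (QI _ _ _ _ _ satA satE ij') _.
    have b1 : K * Pr A + psi (j - i)%N <= b j.
      by apply: lerD; [rewrite ler_wpM2l|apply: psij; exact: leq_trans (leq_sub2l j ij)].
    apply: le_trans (ler_wpM2r (pr_ge0 _ _) b1) _.
    apply: ler_wpM2l => //.
    by rewrite addr_ge0 ?mulr_ge0 ?addr_ge0 ?mulr_ge0 ?powR_ge0 ?pr_ge0.
  (* When the cylinders of [V] are no longer than [j./2], the set [V] itself replaces its hull. *)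
  have [kj|jk] := leqP k j./2.
    apply: (step k V) => //.
    by rewrite lerDl !mulr_ge0 ?powR_ge0.
  apply: (step j./2 (cylinder_hull T P V j./2)) => //.
  - exact: saturated_hull.
  - exact: sub_hull.
  - apply: le_trans (hull _ _) _; first by rewrite hp.
    by rewrite lerD2l.
have JD (F G : nat -> R) : (forall j, (0 < j < J)%N -> F j = 0) ->
    (forall j, 0 <= G j) ->
    (forall j, (J <= j <= D)%N -> F j <= G j) ->
    \sum_(1 <= j < D.+1) F j <= \sum_(J <= j < D.+1) G j.
  move=> F0 G0 FG; have [DJ|DJ] := leqP D.+1 J.
    rewrite big_nat_cond big1 ?sumr_ge0// => j.
    by rewrite andbT => /andP[j1 j2]; apply: F0; rewrite j1 (leq_trans j2).
  rewrite (@big_cat_nat _ _ _ J)//=; [|lia|lia].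
  rewrite big_nat_cond big1 ?add0r; last first.
    by move=> j; rewrite andbT => /F0.
  by rewrite big_nat [leRHS]big_nat; apply: ler_sum => j ?; exact: FG.
apply: le_trans (JD _ (fun j => b j * w) near_hit _ far_hit) _.
  move=> j; rewrite mulr_ge0// addr_ge0 ?mulr_ge0 ?addr_ge0 ?mulr_ge0 ?powR_ge0 ?pr_ge0//.
rewrite -mulr_suml ler_wpM2r// big_split/= -!mulr_sumr; apply: lerD.
  rewrite ler_wpM2l// big_split/= -mulr_sumr; apply: lerD.
    rewrite sumr_const_nat -[leLHS]mulr_natl ler_wpM2r ?pr_ge0// ler_nat.
    by rewrite leq_subLR -addn1 addnC leq_add2r ltnW// ltnW.
  by rewrite ler_wpM2l// mulr_ge0 ?powR_ge0.
by rewrite ler_wpM2l// mulr_ge0 ?powR_ge0.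
Qed.

Variable U : nat -> set X.
Hypothesis goodU : good_neighborhood_system mu T P U.

(** As [u <= 1] and [eps < 1], [u <= u ^ eps]; hence [kappa * u] tends to 0, so a gap that exceeds
    the length of the cylinders is still short compared with [1 / u]. *)
Lemma good_neighborhoods : exists kappa : nat -> nat,
  [/\ forall n, (0 < mu (U n))%E,
      forall n, saturated T P (kappa n) (U n),
      forall e : R, 0 < e -> \forall n \near \oo,
        (kappa n)%:R * Pr (U n) <= e /\ Pr (U n) <= e &
      exists C p : R, [/\ 0 < C, 1 < p & forall n j, (0 < j < kappa n)%N ->
        Pr (cylinder_hull T P (U n) j) <= Pr (U n) + C * j%:R `^ (- p)]].
Proof.
case: goodU => [[U0 _ Ucvg]] [kappa [_ Ukappa _]].
move=> [eps /andP[eps0 eps1] epscvg] [C [p [C0 p1 hull]]].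
have satU n := saturated_union partP (Ukappa n).
have mU n := measurable_sat (satU n).
exists kappa; split => // [e e0|]; last first.
  exists C, p; split => // n j jk.
  rewrite -lee_fin EFinD -!prE//; first exact: hull.
  by apply: measurable_sat; exact: saturated_hull.
have /fine_cvgP[_ /cvgr0Pnorm_le /(_ e e0) H1] := Ucvg.
move: epscvg => /cvgr0Pnorm_le /(_ e e0) H2.
near=> n; split; last first.
  have : `|Pr (U n)| <= e by near: n.
  exact: le_trans (ler_norm _).
have : `|(kappa n)%:R * Pr (U n) `^ eps| <= e by near: n.
apply: le_trans; apply: le_trans (ler_norm _); rewrite ler_wpM2l//.
apply: ger1_powR; last exact: ltW.
by rewrite pr_le1// andbT -lte_fin -prE.
Unshelve. all: by end_near. Qed.

Hypothesis periodU : (essential_period mu T (U n) @[n --> \oo] --> +oo)%E.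

Lemma no_short_returns J : \forall n \near \oo,
  forall j, (0 < j < J)%N -> Pr (iter j T @^-1` U n `&` U n) = 0.
Proof.
move/cvgeyPge: periodU => /(_ J%:R); apply: filterS => n Jn j /andP[j0 jJ].
apply/eqP; rewrite eq_le pr_ge0 andbT leNgt; apply/negP => Pj.
have : (essential_period mu T (U n) <= (j%:R : R)%:E)%E.
  apply: ereal_inf_lbound; exists j => //=; split => //.
  by rewrite lt0e measure_ge0 andbT; apply: contraTN Pj => /eqP ->; rewrite ltxx.
by move/(le_trans Jn); rewrite lee_fin ler_nat leqNgt jJ.
Qed.

(** The order of choices matters: the tails of the two series fix [J] in terms of the tolerance
    alone, and only then is [n] taken large enough to exclude returns before [J]. *)
Lemma localized_rates_of_quasi_independence (K K2 C2 p2 : R) (psi : nat -> R) :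
  quasi_independent K psi -> 0 <= K -> 0 <= K2 -> 0 <= C2 -> 1 < p2 ->
  (forall i, (0 < i)%N -> psi i <= C2 * i%:R `^ (- p2)) ->
  (forall e : R, 0 < e -> \forall n \near \oo, exists c N,
    [/\ (0 < c)%N, (0 < N)%N, (c + N)%:R * Pr (U n) <= e,
      forall r, `|\sum_(0 <= k < N)
            Pr (U n `&` iter (c + k) T @^-1` survivors T (U n) r)
          - N%:R * (Pr (U n) * Pr (survivors T (U n) r))| <=
        e * (N%:R * (Pr (U n) * Pr (survivors T (U n) r))) &
      forall q r, (c <= q)%N ->
        Pr (U n `&` iter q T @^-1` survivors T (U n) r) <=
        K2 * (Pr (U n) * Pr (survivors T (U n) r))]) ->
  [/\ (lower_escape_rate mu T (U n) / mu (U n))%E @[n --> \oo] --> 1%E,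
      (upper_escape_rate mu T (U n) / mu (U n))%E @[n --> \oo] --> 1%E &
      (\forall n \near \oo, cvgn (escape_seq mu T (U n))) ->
        (escape_rate mu T (U n) / mu (U n))%E @[n --> \oo] --> 1%E].
Proof.
move=> QI K0 K20 C20 p21 psile avg.
have [kappa [U0 satU ksmall [C [p [C0 p1 hull]]]]] := good_neighborhoods.
have mU n := measurable_sat (satU n).
apply: localized_escape_rates => // e' e'0.
(* [escape_rate_of_mixing] loses a factor 20 and accepts only tolerances up to [1 / 20]. *)
pose e := Num.min (e' / 20) 20^-1.
have e0 : 0 < e by rewrite lt_min divr_gt0//= invr_gt0.
have e1 : e <= 20^-1 by rewrite ge_min lexx orbT.
have ee' : 20 * e <= e'.
  have h : e <= e' / 20 by rewrite ge_min lexx.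
  by lra.
(* The bound on short returns has three contributions, each kept below [s] before multiplication by
   [K2]. The added 1, here and below, avoids a division by zero. *)
pose s := e / (3 * (K2 + 1)).
have s0 : 0 < s by rewrite divr_gt0// mulr_gt0//; lra.
pose t1 := s / (K + 1) / (C * 3 `^ p).
have t10 : 0 < t1 by rewrite !divr_gt0 ?mulr_gt0 ?powR_gt0//; lra.
pose t2 := s / (C2 + 1) / 3 `^ p2.
have t20 : 0 < t2 by rewrite !divr_gt0 ?mulr_gt0 ?powR_gt0//; lra.
have [J1 HJ1] := powRN_tail p1 t10.
have [J2 HJ2] := powRN_tail p21 t20.
pose J := (J1 + J2 + 3)%N.
have J1J : (J1 <= J)%N by rewrite /J -addnA leq_addr.
have J2J : (J2 <= J)%N by rewrite /J addnAC leq_addl.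
have J3 : (2 < J)%N by rewrite /J addn3.
have tail (q t : R) J' n : 0 < t -> (J' <= J)%N ->
    (forall n, \sum_(J' <= j < n) j%:R `^ (- q) <= t) ->
    \sum_(J <= j < n) j%:R `^ (- q) <= t.
  move=> tt JJ H; have [nJ|Jn] := leqP n J; first by rewrite big_geq ?(ltW tt).
  apply: le_trans (H n); rewrite [leRHS](@big_cat_nat _ _ _ J)//=; last exact: ltnW.
  by rewrite lerDr sumr_ge0// => j _; exact: powR_ge0.
(* [d0] bounds [D * u], both as the loss caused by the delay and, multiplied by [K], as the first
   contribution of the short returns. *)
pose d0 := Num.min e (s / (K + 1)).
have d00 : 0 < d0 by rewrite lt_min e0 divr_gt0//; lra.
have H1 := avg _ d00.
have H2 := no_short_returns J.
near=> n.
have [c [N [c0 N0 cN avgn K2n]]] : exists c N,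
    [/\ (0 < c)%N, (0 < N)%N, (c + N)%:R * Pr (U n) <= d0,
      forall r, `|\sum_(0 <= k < N)
            Pr (U n `&` iter (c + k) T @^-1` survivors T (U n) r)
          - N%:R * (Pr (U n) * Pr (survivors T (U n) r))| <=
        d0 * (N%:R * (Pr (U n) * Pr (survivors T (U n) r))) &
      forall q r, (c <= q)%N ->
        Pr (U n `&` iter q T @^-1` survivors T (U n) r) <=
        K2 * (Pr (U n) * Pr (survivors T (U n) r))] by near: n.
have pern : forall j, (0 < j < J)%N -> Pr (iter j T @^-1` U n `&` U n) = 0.
  by near: n.
have u0 : 0 < Pr (U n) by rewrite -lte_fin -prE.
have d0e : d0 <= e by rewrite ge_min lexx.
have d0s : d0 <= s / (K + 1) by rewrite ge_min lexx orbT.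
have uSge0 r : 0 <= Pr (U n) * Pr (survivors T (U n) r).
  by rewrite mulr_ge0 ?pr_ge0.
have [] := @escape_rate_of_mixing _ _ _ mu T muT (U n) e c N.
- exact: mU.
- exact: u0.
- by rewrite e0.
- by [].
- by [].
- exact: le_trans d0e.
- move=> r; apply: le_trans (avgn r) _.
  by rewrite ler_wpM2r// mulr_ge0.
- move=> r.
  apply: le_trans (@short_returns_le (U n) (kappa n) K K2 C C2 p p2 t1 t2 psi
    J c (c + N) (satU n) QI K0 (ltW C0) C20 _ _ K20 psile (hull n) pern _ _ _
    K2n _ r) _; rewrite ?leq_addr//.
  + by rewrite ltW// (lt_trans _ p1).
  + by rewrite ltW// (lt_trans _ p21).
  + by move=> m; exact: tail HJ1.
  + by move=> m; exact: tail HJ2.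
  rewrite mulrA; apply: ler_wpM2r => //.
  have C30 : C * 3 `^ p != 0 by rewrite mulf_neq0 ?gt_eqF ?powR_gt0.
  have D30 : 3 `^ p2 != 0 :> R by rewrite gt_eqF ?powR_gt0.
  have -> : C * 3 `^ p * t1 = s / (K + 1) by rewrite /t1 mulrC divfK.
  have -> : C2 * 3 `^ p2 * t2 = C2 * (s / (C2 + 1)).
    by rewrite /t2 -mulrA [3 `^ p2 * _]mulrC divfK.
  have h1 : K * ((c + N)%:R * Pr (U n)) <= s.
    have : K * ((c + N)%:R * Pr (U n)) <= K * (s / (K + 1)).
      by rewrite ler_wpM2l//; exact: le_trans d0s.
    move/le_trans; apply; rewrite mulrCA ler_piMr ?(ltW s0)//.
    by rewrite ler_pdivrMr; lra.
  have h2 : K * (s / (K + 1)) <= s.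
    by rewrite mulrCA ler_piMr ?(ltW s0)// ler_pdivrMr; lra.
  have h3 : C2 * (s / (C2 + 1)) <= s.
    by rewrite mulrCA ler_piMr ?(ltW s0)// ler_pdivrMr; lra.
  have h4 : (3 * s) * (K2 + 1) = e by rewrite /s; field; lra.
  rewrite mulrDr.
  apply: (@le_trans _ _ (3 * s * K2)); first by rewrite ler_wpM2r//; lra.
  by rewrite -h4 mulrDr; lra.
move=> h1 h2; have mu0 : (0 <= mu (U n))%E by [].
split; first by apply: le_trans h1; rewrite lee_wpmul2r// lee_fin; lra.
by apply: le_trans h2 _; rewrite lee_wpmul2r// lee_fin; lra.
Unshelve. all: by end_near. Qed.

End quasi_independence.

(** * Right phi-mixing systems *)

Section phi_mixing.
Context {d : measure_display} {X : measurableType d} {R : realType}.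
Variables (mu : probability X R) (T : X -> X) (P : set (set X)).
Hypothesis muT : measure_preserving mu T.
Hypothesis mP : measurable_partition P.
Variables (phi : nat -> R) (C p : R).
Hypothesis phimix : right_phi_mixing mu T P phi.
Hypothesis C0 : 0 < C.
Hypothesis p1 : 1 < p.
Hypothesis philt : forall k : nat, (0 < k)%N -> phi k <= C * k%:R `^ (- p).
Local Notation Pr A := (fine (mu A)).

Let mT : measurable_fun [set: X] T. Proof. by case: muT. Qed.

Lemma phi_mixing_pr i k m A B : saturated T P i A -> saturated T P m B ->
  `|Pr (A `&` iter (i + k) T @^-1` B) - Pr A * Pr B| <= phi k * Pr B.
Proof.
move=> satA satB; have mA := measurable_sat muT mP satA.
have mB := measurable_sat muT mP satB.
have mI : measurable (A `&` iter (i + k) T @^-1` B).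
  by apply: measurableI => //; exact: measurable_pre.
case: mP => cP mP' pP; case: phimix => _ _ /(_ i k A B).
rewrite (prE mu mI) (prE mu mA) (prE mu mB) -!EFinM -EFinB abse_EFin lee_fin; apply.
  exact: saturated_sigma.
exact: saturated_sigma_bigcup satB.
Qed.

Lemma phi_mixing_quasi_independent : quasi_independent mu T P 1 phi.
Proof.
move=> i j m A B satA satB ij.
have := phi_mixing_pr (j - i) satA satB; rewrite subnKC// ler_norml => /andP[_].
by rewrite lerBlDr mul1r mulrDl addrC.
Qed.

(** A gap [k] close to [e' / (4 * u)] is short enough for the delay and long enough for mixing,
    since [phi k] is then of order [u ^ p]. A window with a single gap suffices. *)
Lemma localized_rates_of_phi_mixing (U : nat -> set X) :
  good_neighborhood_system mu T P U ->
  (essential_period mu T (U n) @[n --> \oo] --> +oo)%E ->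
  [/\ (lower_escape_rate mu T (U n) / mu (U n))%E @[n --> \oo] --> 1%E,
      (upper_escape_rate mu T (U n) / mu (U n))%E @[n --> \oo] --> 1%E &
      (\forall n \near \oo, cvgn (escape_seq mu T (U n))) ->
        (escape_rate mu T (U n) / mu (U n))%E @[n --> \oo] --> 1%E].
Proof.
move=> goodU periodU.
apply: (localized_rates_of_quasi_independence muT mP goodU periodU
  phi_mixing_quasi_independent (K2 := 2) (C2 := C) (p2 := p)) => //.
  exact: ltW.
move=> e e0.
have [kappa [U0 satU ksmall _]] := good_neighborhoods muT mP goodU.
pose e' := Num.min e 1.
have e'0 : 0 < e' by rewrite lt_min e0 ltr01.
have e'e : e' <= e by rewrite ge_min lexx.
have e'1 : e' <= 1 by rewrite ge_min lexx orbT.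
pose c1 := C * (8 / e') `^ p.
have c10 : 0 < c1 by rewrite mulr_gt0// powR_gt0// divr_gt0.
(* Below this threshold [c1 * u ^ (p - 1) <= e'], that is, [c1 * u ^ p <= e' * u]. *)
pose w := (e' / c1) `^ (p - 1)^-1.
have w0 : 0 < w by rewrite powR_gt0// divr_gt0.
pose s := Num.min w (e' / 8).
have s0 : 0 < s by rewrite lt_min w0 divr_gt0.
have s4 : 0 < e' / 4 by rewrite divr_gt0.
near=> n.
have u0 : 0 < Pr (U n).
  by rewrite -lte_fin -prE//; exact: (measurable_sat muT mP (satU n)).
have [_ us] : (kappa n)%:R * Pr (U n) <= s /\ Pr (U n) <= s.
  by near: n; exact: ksmall.
have [ku _] : (kappa n)%:R * Pr (U n) <= e' / 4 /\ Pr (U n) <= e' / 4.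
  by near: n; exact: ksmall.
have uw : Pr (U n) <= w by rewrite (le_trans us)// ge_min lexx.
have u8 : Pr (U n) <= e' / 8 by rewrite (le_trans us)// ge_min lexx orbT.
set u := Pr (U n) in u0 us ku uw u8 *.
pose k := Num.truncn (e' / 4 / u).
have k1 : k%:R <= e' / 4 / u by rewrite truncn_le divr_ge0 ?(ltW s4) ?(ltW u0).
have k2 : e' / 8 / u <= k%:R.
  have : e' / 4 / u < k%:R + 1 by rewrite natr1; exact: truncnS_gt.
  have : 1 <= e' / 8 / u by rewrite ler_pdivlMr// mul1r.
  have -> : e' / 4 / u = 2 * (e' / 8 / u) by field; lra.
  by lra.
have z0 : 0 < e' / 8 / u by rewrite !divr_gt0.
have k0 : (0 < k)%N by rewrite -(ltr0n R); exact: lt_le_trans k2.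
have phik : phi k <= e' * u.
  apply: le_trans (philt k0) _.
  have p0 : 0 <= p by rewrite ltW// (lt_trans _ p1).
  apply: (@le_trans _ _ (C * (e' / 8 / u) `^ (- p))).
    by rewrite ler_pM2l//; exact: powRN_le.
  have -> : (e' / 8 / u) `^ (- p) = (8 / e') `^ p * u `^ p.
    rewrite -powRM ?divr_ge0 ?(ltW u0) ?(ltW e'0)//.
    have -> : 8 / e' * u = (e' / 8 / u)^-1 by field; lra.
    by rewrite -(powR_inv1 (ltW z0)) -powRrM mulN1r.
  rewrite mulrA -/c1.
  have -> : u `^ p = u * u `^ (p - 1).
    by rewrite -{2}(powRr1 (ltW u0)) -powRD ?(gt_eqF u0) ?implybT// addrC subrK.
  rewrite mulrCA [leRHS]mulrC ler_pM2l//.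
  have -> : e' = c1 * (e' / c1) by field; lra.
  rewrite ler_pM2l//.
  have -> : e' / c1 = w `^ (p - 1).
    by rewrite /w -powRrM mulVf ?subr_eq0 ?gt_eqF// powRr1// divr_ge0 ?ltW.
  by apply: ge0_ler_powR => //; rewrite ?nnegrE ?(ltW u0) ?(ltW w0)// subr_ge0 ltW.
have uSge0 r : 0 <= u * Pr (survivors T (U n) r) by rewrite mulr_ge0 ?pr_ge0.
have satS r := saturated_survivors (t := r) (let: And3 _ _ pP := mP in pP) (satU n).
(* The products of [kappa n], [k] and 1 with [u] are at most [e' / 4], [e' / 4] and [e' / 8]. For
   longer gaps monotonicity of [phi] leaves the factor [1 + e' <= 2], whence [K2 = 2]. *)
exists (kappa n + k)%N, 1%N; split => //.
- by rewrite addn_gt0 k0 orbT.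
- rewrite !natrD !mulrDl mul1r.
  have : k%:R * u <= e' / 4 by rewrite -ler_pdivlMr.
  by lra.
- move=> r; rewrite big_nat1 addn0 !mul1r.
  apply: le_trans (phi_mixing_pr k (satU n) (satS r)) _.
  rewrite mulrA ler_wpM2r ?pr_ge0//; apply: le_trans phik _.
  by rewrite ler_pM2r.
- move=> q r cq.
  have kq : (kappa n <= q)%N by apply: leq_trans cq; exact: leq_addr.
  apply: le_trans (phi_mixing_quasi_independent (satU n) (satS r) kq) _.
  rewrite mul1r mulrA ler_wpM2r ?pr_ge0//.
  case: phimix => phidec _ _.
  have : phi (q - kappa n)%N <= phi k by apply: phidec; rewrite leq_subRL.
  have : e' * u <= u by rewrite ler_piMl// ltW.
  rewrite -/u; lra.
Unshelve. all: by end_near. Qed.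

End phi_mixing.

(** * Cesaro mixing of ergodic maps *)

Section expectation.
Context {d : measure_display} {X : measurableType d} {R : realType}.
Variable mu : probability X R.
Implicit Types f g : X -> R.
Local Notation Pr A := (fine (mu A)).

(** In this class integrals are finite, so that expectations can be handled as real numbers. *)
Definition nonneg_bounded f :=
  [/\ measurable_fun [set: X] f, forall x, 0 <= f x & exists b, forall x, f x <= b].

Definition mean f : R := fine (\int[mu]_x (f x)%:E)%E.

Lemma nonneg_boundedD f g : nonneg_bounded f -> nonneg_bounded g ->
  nonneg_bounded (fun x => f x + g x).
Proof.
move=> [mf f0 [b fb]] [mg g0 [c gc]]; split; first exact: measurable_funD.
  by move=> x; exact: addr_ge0.
by exists (b + c) => x; exact: lerD.
Qed.

Lemma nonneg_boundedZ k f : 0 <= k -> nonneg_bounded f ->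
  nonneg_bounded (fun x => k * f x).
Proof.
move=> k0 [mf f0 [b fb]]; split; first exact: measurable_funM.
  by move=> x; exact: mulr_ge0.
by exists (k * b) => x; rewrite ler_wpM2l.
Qed.

Lemma nonneg_bounded_indic (A : set X) : measurable A ->
  nonneg_bounded (\1_A : X -> R).
Proof.
move=> mA; split; first exact: measurable_indic.
  by move=> x; rewrite indicE.
by exists 1 => x; rewrite indicE lern1; case: (_ \in _).
Qed.

Lemma mean_fin f : nonneg_bounded f ->
  (\int[mu]_x (f x)%:E)%E = (mean f)%:E.
Proof.
move=> [mf f0 [b fb]]; rewrite fineK// ge0_fin_numE; last first.
  by apply: integral_ge0 => x _; rewrite lee_fin.
apply: (@le_lt_trans _ _ (\int[mu]_x (b%:E))%E).
  apply: ge0_le_integral => //; first by move=> x _; rewrite lee_fin.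
    exact/measurable_EFinP.
  by move=> x _; rewrite lee_fin.
by rewrite integral_cst//= probability_setT mule1 ltry.
Qed.

Lemma mean_le f g : nonneg_bounded f -> nonneg_bounded g ->
  (forall x, f x <= g x) -> mean f <= mean g.
Proof.
move=> bf bg fg; rewrite -lee_fin -!mean_fin//.
case: bf bg => [mf f0 _] [mg g0 _].
apply: ge0_le_integral => //; try exact/measurable_EFinP.
  by move=> x _; rewrite lee_fin.
by move=> x _; rewrite lee_fin.
Qed.

Lemma meanD f g : nonneg_bounded f -> nonneg_bounded g ->
  mean (fun x => f x + g x) = mean f + mean g.
Proof.
move=> bf bg; apply: EFin_inj; rewrite EFinD -!mean_fin//; last exact: nonneg_boundedD.
case: bf bg => [mf f0 _] [mg g0 _].
rewrite -ge0_integralD//; try exact/measurable_EFinP.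
  by move=> x _; rewrite lee_fin.
by move=> x _; rewrite lee_fin.
Qed.

Lemma meanZ k f : 0 <= k -> nonneg_bounded f ->
  mean (fun x => k * f x) = k * mean f.
Proof.
move=> k0 bf; apply: EFin_inj; rewrite EFinM -!mean_fin//; last exact: nonneg_boundedZ.
case: bf => [mf f0 _]; rewrite -ge0_integralZl_EFin//; try exact/measurable_EFinP.
by move=> x _; rewrite lee_fin.
Qed.

Lemma mean_indic (A : set X) : measurable A -> mean \1_A = Pr A.
Proof. by move=> mA; rewrite /mean integral_indic// setIT. Qed.

Variable T : X -> X.
Hypothesis muT : measure_preserving mu T.

Lemma nonneg_bounded_comp f : nonneg_bounded f -> nonneg_bounded (f \o T).
Proof.
case: muT => mT _ [mf f0 [b fb]]; split; first exact: measurableT_comp.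
  by move=> x; exact: f0.
by exists b => x; exact: fb.
Qed.

Lemma mean_comp f : nonneg_bounded f -> mean (f \o T) = mean f.
Proof.
case: muT => mT muT' [mf f0 _]; congr fine.
have -> : (\int[mu]_x (f x)%:E = \int[pushforward mu T]_x (f x)%:E)%E.
  by apply: eq_measure_integral => A mA _; rewrite -[LHS](muT' A mA).
rewrite ge0_integral_pushforward//; first exact/measurable_EFinP.
by move=> y _; rewrite lee_fin.
Qed.

End expectation.

Section cesaro_mixing.
Context {d : measure_display} {X : measurableType d} {R : realType}.
Variables (mu : probability X R) (T : X -> X).
Hypothesis muT : measure_preserving mu T.
Local Notation Pr A := (fine (mu A)).

Let mT : measurable_fun [set: X] T. Proof. by case: muT. Qed.

Section maximal_inequality.
Variables (E : set X) (c : R).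
Hypotheses (mE : measurable E) (c0 : 0 <= c).

(* [max_excess n x] is the maximum over [j <= n] of the Birkhoff sums
   [\sum_(k < j) (\1_E (T^k x) - c)]. *)
Fixpoint max_excess n (x : X) : R :=
  if n is n'.+1 then Num.max 0 (\1_E x - c + max_excess n' (T x)) else 0.

Lemma max_excess_ge0 n x : 0 <= max_excess n x.
Proof. by case: n => [//|n] /=; rewrite le_max lexx. Qed.

Lemma max_excess_le n x : max_excess n x <= n%:R.
Proof.
elim: n x => [//|n IH] x /=; rewrite ge_max ler0n/= -natr1.
have := IH (T x); have : \1_E x <= 1 :> R by rewrite indicE lern1; case: (_ \in _).
by move: c0; lra.
Qed.

Lemma max_excess_leS n x : max_excess n x <= max_excess n.+1 x.
Proof.
elim: n x => [|n IH] x /=; first exact: (max_excess_ge0 1).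
by rewrite ge_max le_max lexx/= le_max lerD2l IH orbT.
Qed.

Lemma max_excess_le_mono m n x : (m <= n)%N -> max_excess m x <= max_excess n x.
Proof.
move=> /subnK <-; elim: (n - m)%N => [//|k IH].
by apply: le_trans IH _; rewrite addSn; exact: max_excess_leS.
Qed.

Lemma nonneg_bounded_max_excess n : nonneg_bounded (max_excess n).
Proof.
split; [|exact: max_excess_ge0|by exists n%:R => x; exact: max_excess_le].
elim: n => [|n IH]; first exact: measurable_cst.
apply: measurable_maxr; first exact: measurable_cst.
apply: measurable_funD; last exact: measurableT_comp.
apply: measurable_funB; [exact: measurable_indic|exact: measurable_cst].
Qed.

Lemma measurable_excess_gt n (b : R) : measurable [set x | b < max_excess n x].
Proof.
rewrite -preimage_itvoy -[X in measurable X]setTI.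
by case: (nonneg_bounded_max_excess n) => mM _ _; exact: mM.
Qed.

(** Garsia's argument: on [Q] the maximum equals [\1_E - c] plus the previous maximum at [T x]; off
    [Q] it vanishes. Integration, invariance and the monotonicity of [max_excess] in [n] give the
    claim. Terms are moved across the inequality so that all integrands are nonnegative. *)
Lemma maximal_inequality n (Q := [set x | 0 < max_excess n.+1 x]) :
  c * Pr Q <= Pr (E `&` Q).
Proof.
have mQ : measurable Q by exact: measurable_excess_gt.
have mEQ := measurableI _ _ mE mQ.
have bM := nonneg_bounded_max_excess.
have bQ := nonneg_boundedZ c0 (nonneg_bounded_indic (R := R) mQ).
have bEQ := nonneg_bounded_indic (R := R) mEQ.
have bMT := nonneg_bounded_comp muT (bM n).
have : mean mu (fun x => max_excess n.+1 x + c * \1_Q x) <=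
    mean mu (fun x => \1_(E `&` Q) x + (max_excess n \o T) x).
  apply: mean_le; [exact: nonneg_boundedD|exact: nonneg_boundedD|] => x.
  have -> : \1_(E `&` Q) x = \1_E x * (x \in Q)%:R :> R.
    by rewrite indicI /= [\1_Q x]indicE.
  rewrite [\1_Q x]indicE; have [xQ|xQ] := boolP (x \in Q).
    move: (xQ); rewrite inE /Q /= lt_max ltxx/= => h.
    rewrite !mulr1 max_r ?(ltW h)//; lra.
  have : max_excess n.+1 x <= 0.
    by rewrite leNgt; apply: contra xQ => h; rewrite inE.
  have := max_excess_ge0 n (T x); rewrite mulr0n !mulr0 !add0r addr0 /=; lra.
rewrite !meanD// meanZ//; last exact: nonneg_bounded_indic.
rewrite !mean_indic// mean_comp//.
have := mean_le mu (bM n) (bM n.+1) (max_excess_leS n); lra.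
Qed.

Lemma birkhoff_le_max_excess n x :
  \sum_(0 <= k < n) \1_E (iter k T x) <= c * n%:R + max_excess n x.
Proof.
elim: n x => [|n IH] x; first by rewrite big_geq// mulr0 addr0.
rewrite big_nat_recl// -natr1.
under eq_bigr do rewrite iterSr.
have := IH (T x).
have : \1_E x - c + max_excess n (T x) <= max_excess n.+1 x.
  by rewrite /= le_max lexx orbT.
rewrite [iter 0 T x]/=; lra.
Qed.

Hypothesis ergT : ergodic mu T.
Hypothesis cE : Pr E < c.

(** The set where the excess is unbounded in [n] is invariant, hence null or of full measure, and
    the maximal inequality excludes the latter. Continuity of the measure then gives one level [L]
    for all [n]. *)
Lemma max_excess_bounded (e : R) : 0 < e -> exists L : nat,
  forall n, Pr [set x | L%:R < max_excess n x] <= e.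
Proof.
move=> e0.
pose F L := \bigcup_n [set x | L%:R < max_excess n x].
have mF L : measurable (F L).
  by apply: bigcupT_measurable => n; exact: measurable_excess_gt.
pose G := \bigcap_L F L.
have mG : measurable G by apply: bigcapT_measurable.
(* One step of [T] changes the excess by at most [1 + c], which is absorbed by raising the level
   from [L] to [L + N]. *)
have GT : T @^-1` G = G.
  have bnd x : `|\1_E x - c| <= 1 + c.
    rewrite (le_trans (ler_normB _ _))// (ger0_norm c0) lerD2r.
    by rewrite indicE; case: (_ \in _); rewrite ?normr1 ?normr0.
  have [N cN] : exists N : nat, 1 + c <= N%:R.
    by exists (Num.truncn (1 + c)).+1; rewrite ltW// truncnS_gt.
  apply/seteqP; split => x Gx L _.
    have [n _ /= h] := Gx (L + N)%N I; exists n.+1 => //=.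
    rewrite lt_max; apply/orP; right.
    have := bnd x; rewrite ler_norml => /andP[+ _]; rewrite natrD in h; lra.
  have [[|n] _ /= h] := Gx (L + N)%N I.
    by move: h; rewrite ltNge ler0n.
  exists n => //=; move: h; rewrite lt_max ltNge ler0n/= natrD => h.
  have := bnd x; rewrite ler_norml => /andP[_]; lra.
have G0 : Pr G = 0.
  (* If [G] had full measure, the sets [Q n] would exhaust the space up to a null set, and the
     maximal inequality would give [c <= Pr E] in the limit. *)
  have [->//|G1] := ergT mG GT.
  suff : c <= Pr E by rewrite leNgt cE.
  pose Q n := [set x | 0 < max_excess n.+1 x].
  have mQ n : measurable (Q n) by exact: measurable_excess_gt.
  have GQ : G `<=` \bigcup_n Q n.
    move=> x /(_ 0%N I)[[|n] _ /= h]; first by rewrite ltxx in h.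
    by exists n.
  have mUQ : measurable (\bigcup_n Q n) by exact: bigcupT_measurable.
  have Q1 : mu (\bigcup_n Q n) = 1%E.
    apply/eqP; rewrite eq_le probability_le1//= -G1.
    by apply: le_measure; rewrite ?inE.
  have Qcvg : mu (Q n) @[n --> \oo] --> 1%E.
    rewrite -Q1; apply: nondecreasing_cvg_mu => //.
    move=> m n mn; apply/subsetPset => x /= h; apply: lt_le_trans h _.
    exact: max_excess_le_mono.
  have /fine_cvgP[_ Qcvg'] := Qcvg.
  have : (c * Pr (Q n) @[n --> \oo] --> c * 1)%R.
    by apply: cvgMr; exact: Qcvg'.
  rewrite mulr1 => /cvgr_to_le; apply; apply: nearW => n.
  apply: le_trans (maximal_inequality n) _.
  by apply: pr_le => //; exact: (measurableI _ _ mE (mQ n)).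
have Fcvg : mu (F n) @[n --> \oo] --> mu G.
  apply: nonincreasing_cvg_mu => //.
    by rewrite (le_lt_trans (probability_le1 _ _))// ltry.
  move=> m n mn; apply/subsetPset => x [k _ /= h]; exists k => //=.
  by apply: le_lt_trans h; rewrite ler_nat.
move: Fcvg; rewrite (prE mu mG) G0 => /fine_cvgP[_ /cvgr0Pnorm_le /(_ e e0)].
move=> [L _ /(_ L (leqnn L)) /= FL]; exists L => n.
apply: le_trans (le_trans (ler_norm _) FL).
apply: pr_le => //; first exact: measurable_excess_gt.
by move=> x h; exists n.
Qed.

End maximal_inequality.

Hypothesis ergT : ergodic mu T.

(** The Birkhoff sum of [\1_E] is at most [c * N] plus the excess, which is at most [L] off a small
    set [B] and at most [N] on [B]. Each third of [e] pays for one loss: the choice of [c], the set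
    [B] and the quotient [L / N]. *)
Lemma cesaro_mixing_le (A E : set X) (e : R) : measurable A -> measurable E ->
  0 < e -> \forall N \near \oo,
    \sum_(0 <= k < N) Pr (A `&` iter k T @^-1` E) <= N%:R * (Pr A * Pr E + e).
Proof.
move=> mA mE e0; pose c := Pr E + e / 3.
have c0 : 0 <= c by rewrite addr_ge0 ?pr_ge0// ltW// divr_gt0.
have cE : Pr E < c by rewrite ltrDl divr_gt0.
have e3 : 0 < e / 3 by rewrite divr_gt0.
have [L HL] := max_excess_bounded mE c0 ergT cE e3.
near=> N.
have LN : L%:R <= e / 3 * N%:R.
  rewrite mulrC -ler_pdivrMr//; near: N; exact: nbhs_infty_ger.
pose B := [set x | L%:R < max_excess E c N x].
have mB : measurable B by exact: measurable_excess_gt.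
have mEk k : measurable (A `&` iter k T @^-1` E).
  by apply: measurableI => //; exact: measurable_pre.
have bS (n : nat) :
    nonneg_bounded (fun x => \sum_(0 <= k < n) \1_(A `&` iter k T @^-1` E) x : R) /\
    mean mu (fun x => \sum_(0 <= k < n) \1_(A `&` iter k T @^-1` E) x) =
    \sum_(0 <= k < n) Pr (A `&` iter k T @^-1` E).
  elim: n => [|n [IH1 IH2]].
    rewrite big_geq//; under eq_fun do rewrite big_geq//.
    rewrite -[X in mean mu X = _](_ : \1_set0 = _); last first.
      by apply/funext => x; rewrite indicE in_set0.
    rewrite mean_indic// measure0; split => //; split => //.
    by exists 0.
  have bn := nonneg_bounded_indic (R := R) (mEk n).
  rewrite big_nat_recr//= -IH2 -mean_indic// -meanD//.
  have -> : (fun x => \sum_(0 <= k < n.+1) \1_(A `&` iter k T @^-1` E) x : R) =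
     (fun x => \sum_(0 <= k < n) \1_(A `&` iter k T @^-1` E) x +
       \1_(A `&` iter n T @^-1` E) x).
    by apply/funext => x; rewrite big_nat_recr.
  by split => //; exact: nonneg_boundedD.
have [bSN <-] := bS N.
have bA := nonneg_bounded_indic (R := R) mA.
have bB := nonneg_bounded_indic (R := R) mB.
have bX := nonneg_bounded_indic (R := R) (@measurableT _ X).
have k1 : 0 <= c * N%:R by rewrite mulr_ge0.
have k2 : 0 <= N%:R :> R by [].
have k3 : 0 <= e / 3 * N%:R by rewrite mulr_ge0// ltW.
have b1 := nonneg_boundedZ k1 bA.
have b2 := nonneg_boundedZ k2 bB.
have b3 := nonneg_boundedZ k3 bX.
apply: (@le_trans _ _ (mean mu (fun x =>
    (c * N%:R * \1_A x + N%:R * \1_B x) + e / 3 * N%:R * \1_setT x))).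
  apply: mean_le => //; first by do 2 apply: nonneg_boundedD => //.
  move=> x.
  have -> : \sum_(0 <= k < N) \1_(A `&` iter k T @^-1` E) x =
      \1_A x * \sum_(0 <= k < N) \1_E (iter k T x) :> R.
    rewrite mulr_sumr; apply: eq_bigr => k _; rewrite indicI /=.
    by congr (_ * _); rewrite !indicE !inE.
  have hb := birkhoff_le_max_excess E c N x.
  have exB : max_excess E c N x <= N%:R * \1_B x + e / 3 * N%:R.
    rewrite indicE; have [xB|xB] := boolP (x \in B).
      by rewrite mulr1 (le_trans (max_excess_le E c0 _ _))// lerDl.
    rewrite mulr0 add0r; apply: le_trans LN; rewrite leNgt.
    by apply: contra xB => h; rewrite inE.
  rewrite [\1_A x]indicE indicT mulr1.
  case: (x \in A); rewrite /= ?mul1r ?mulr1 ?mul0r ?mulr0 ?add0r.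
    by lra.
  by rewrite addr_ge0// mulr_ge0.
rewrite !meanD//; last exact: nonneg_boundedD.
rewrite !meanZ// !mean_indic// prT.
have := HL N; rewrite -/B => PB.
have PA := pr_le1 mu mA; have PA0 := pr_ge0 mu A; have PE0 := pr_ge0 mu E.
have h1 : N%:R * Pr B <= N%:R * (e / 3) by rewrite ler_wpM2l.
have h2 : N%:R * (e / 3) * Pr A <= N%:R * (e / 3) by rewrite ler_piMr// mulrC.
by rewrite /c mulrDl mulrDl mulr1 !mulrDr; lra.
Unshelve. all: by end_near. Qed.

(** The lower bound is the upper bound for the complement of [E]. *)
Lemma cesaro_mixing (A E : set X) (e : R) : measurable A -> measurable E ->
  0 < e -> \forall N \near \oo,
    `|\sum_(0 <= k < N) Pr (A `&` iter k T @^-1` E) - N%:R * (Pr A * Pr E)|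
      <= N%:R * e.
Proof.
move=> mA mE e0; have mC := measurableC mE.
have H1 := cesaro_mixing_le mA mE e0; have H2 := cesaro_mixing_le mA mC e0.
near=> N.
have : \sum_(0 <= k < N) Pr (A `&` iter k T @^-1` E) <= N%:R * (Pr A * Pr E + e).
  by near: N.
have : \sum_(0 <= k < N) Pr (A `&` iter k T @^-1` (~` E)) <=
    N%:R * (Pr A * Pr (~` E) + e) by near: N.
have -> : \sum_(0 <= k < N) Pr (A `&` iter k T @^-1` (~` E)) =
    N%:R * Pr A - \sum_(0 <= k < N) Pr (A `&` iter k T @^-1` E).
  rewrite mulr_natl -[X in _ *+ X]subn0 -sumr_const_nat -sumrB.
  apply: eq_bigr => k _.
  rewrite (pr_split mu mA (measurable_pre mT k mE)) preimage_setC.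
  by rewrite addrC addKr.
rewrite prC// => h1 h2; rewrite ler_norml; apply/andP; split; lra.
Unshelve. all: by end_near. Qed.

End cesaro_mixing.

(** * Bounded distortion of Gibbs-Markov maps *)

Section distortion.
Context {d : measure_display} {X : measurableType d} {R : realType}.
Variables (mu : probability X R) (T : X -> X) (P : set (set X)).
Hypothesis mP : measurable_partition P.
Hypothesis genP : generating T P.
Hypothesis GM : gibbs_markov mu T P.
Local Notation Pr A := (fine (mu A)).
Local Notation cyl := (cyl T P).

Let muT : measure_preserving mu T. Proof. by case: GM. Qed.
Let mT : measurable_fun [set: X] T. Proof. by case: muT. Qed.
Let partP : partition P id [set: X]. Proof. by case: mP. Qed.

Lemma measurable_cyl n x : measurable (cyl n x).
Proof. exact: (measurable_sat muT mP (@saturated_cyl _ _ T P n x)). Qed.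

Lemma cyl_addn n m x :
  cyl (n + m) x = cyl n x `&` iter n T @^-1` cyl m (iter n T x).
Proof.
apply/seteqP; split => y.
  by move=> xy; split; [apply: itin_le xy; exact: leq_addr|exact: itin_shift].
by move=> [h1 h2]; exact: itin_glue.
Qed.

(** Distinct points are eventually separated because [P] is generating; so the maximum that defines
    [sep_time] exists, and the default value of [xget] does not intervene. *)
Lemma sep_dist_le (lambda : R) n x y : 0 < lambda < 1 ->
  same_itinerary T P n x y -> sep_dist T P lambda x y <= lambda ^+ n.
Proof.
move=> /andP[l0 l1] xy; rewrite /sep_dist; case: eqVneq => [_|/eqP nxy].
  by rewrite exprn_ge0// ltW.
have [N nN] : exists N, ~ cylinder_at T P N x y.
  apply/existsNP => H; apply: nxy; apply/esym.
  by have : [set x] y by rewrite -(genP x).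
have bnd m : cylinder_at T P m x y -> (m <= N)%N.
  rewrite !(cylinder_atE _ partP) in nN * => xym; rewrite leqNgt; apply/negP => Nm.
  by apply: nN; apply: itin_le xym; exact: ltnW.
have ex : exists m, `[<cylinder_at T P m x y>].
  by exists n; apply/asboolP; rewrite (cylinder_atE _ partP).
have ub m : `[<cylinder_at T P m x y>] -> (m <= N)%N by move=> /asboolP; exact: bnd.
have [m xym mmax] := ex_maxnP ex ub.
have [h1 h2] := @xgetI nat 0%N [set n | cylinder_at T P n x y /\
    forall m, cylinder_at T P m x y -> (m <= n)%N] m
  (conj (elimT (asboolP _) xym) (fun k h => mmax k (introT (asboolP _) h))).
apply: ler_wiXn2l; rewrite ?ltW//; apply: h2.
by rewrite (cylinder_atE _ partP).
Qed.

(** On an [n]-cylinder [g] varies by a factor at most [exp (K * lambda ^+ n)], and integrating it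
    over [D] against the measure [mu o T] compares [Pr D] with [g x * Pr (T D)]. The condition
    [0 < n] puts [D] inside one element of [P]. *)
Lemma jacobian_distortion : exists lambda K : R, exists g : X -> R,
  [/\ 0 < lambda < 1, 0 <= K, forall x, 0 < g x &
    forall n x D, (0 < n)%N -> measurable D -> D `<=` cyl n x ->
      [/\ measurable (T @` D),
          expR (- (K * lambda ^+ n)) * (g x * Pr (T @` D)) <= Pr D &
          Pr D <= expR (K * lambda ^+ n) * (g x * Pr (T @` D))]].
Proof.
case: GM => _ _ _ [lambda [g [l01 [mg g0 [nu nuE jacE]] [K HK]]]].
exists lambda, `|K|, g; split => // n x D n0 mD Dx.
have [A PA Ax] := partition_ex partP x.
have xA y : cyl n x y -> A y by move=> xy; exact: (xy 0%N).
have DA : D `<=` A by move=> y /Dx/xA.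
have [mTD nuD] := nuE A D PA mD DA.
have l0 : 0 <= lambda by case/andP: l01 => /ltW.
have lng y : D y -> `|ln (g y) - ln (g x)| <= `|K| * lambda ^+ n.
  move=> Dy; apply: le_trans (HK A y x PA (DA _ Dy) Ax) _.
  apply: (@le_trans _ _ (`|K| * sep_dist T P lambda y x)).
    rewrite ler_wpM2r ?ler_norm//; rewrite /sep_dist; case: ifP => // _.
    exact: exprn_ge0.
  rewrite ler_wpM2l//; apply: sep_dist_le => //.
  by apply: itin_sym => //; exact: Dx.
have gup y : D y -> g y <= expR (`|K| * lambda ^+ n) * g x.
  move=> /lng; rewrite ler_norml => /andP[_].
  rewrite lerBlDr => h.
  have := ler_expR (ln (g y)) (`|K| * lambda ^+ n + ln (g x)).
  by rewrite h expRD !lnK ?posrE.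
have glo y : D y -> expR (- (`|K| * lambda ^+ n)) * g x <= g y.
  move=> /lng; rewrite ler_norml => /andP[+ _].
  rewrite lerBrDr => h.
  have := ler_expR (- (`|K| * lambda ^+ n) + ln (g x)) (ln (g y)).
  by rewrite h expRD !lnK ?posrE.
have mgE : measurable_fun D (EFin \o g).
  by apply/measurable_EFinP; exact: measurable_funTS.
have muD := jacE D mD.
split => //; rewrite -lee_fin EFinM EFinM -!prE// -nuD muD.
  rewrite muleA -EFinM -integral_cst//; apply: ge0_le_integral => //.
  by move=> y _; rewrite lee_fin mulr_ge0 ?expR_ge0// ltW.
rewrite muleA -EFinM -integral_cst//; apply: ge0_le_integral => //.
by move=> y _; rewrite lee_fin ltW.
Qed.

(** The ratio of [Pr (A and T^-n D)] to [Pr D] is almost the same for all [D] inside one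
    [m]-cylinder, uniformly in [n] and in the past [A]. Cross-multiplication admits null sets. *)
Definition distortion_bound (lambda c : R) :=
  forall n m A z D1 D2, saturated T P n A -> (0 < m)%N ->
    measurable D1 -> measurable D2 -> D1 `<=` cyl m z -> D2 `<=` cyl m z ->
    Pr (A `&` iter n T @^-1` D1) * Pr D2 <=
    expR (c * lambda ^+ m) * (Pr (A `&` iter n T @^-1` D2) * Pr D1).

Lemma branch_image A y n : P A -> A y -> (0 < n)%N ->
  cyl n (T y) `<=` T @` A.
Proof.
move=> PA Ay n0; case: GM => [[_ _ TA] _ _ _].
have [G GP TAE] := TA A PA.
have : (T @` A) (T y) by exists y.
rewrite TAE => -[B GB BTy] z zy; exists B => //.
exact: (zy 0%N B n0 (GP _ GB) BTy).
Qed.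

(** An inverse branch of [T^n] is composed of one-step branches. The [i]-th of them acts on sets
    inside cylinders of length [m + i] and contributes [2 * K * lambda ^+ (m + i)] to the exponent;
    the series is geometric, so the bound is uniform in [n]. *)
Lemma bounded_distortion_iter : exists lambda c : R,
  [/\ 0 < lambda < 1, 0 <= c & distortion_bound lambda c].
Proof.
have [lambda [K [g [/andP[l0 l1] K0 g0 jac]]]] := jacobian_distortion.
pose s (n : nat) := \sum_(0 <= i < n) lambda ^+ i.+1.
have sle n : s n <= lambda / (1 - lambda).
  have -> : s n = lambda / (1 - lambda) * (1 - lambda ^+ n).
    elim: n => [|n IH]; first by rewrite /s big_geq// expr0 subrr mulr0.
    rewrite /s big_nat_recr//= -/(s n) IH exprS; field; lra.
  rewrite ler_piMr ?divr_ge0 ?(ltW l0)//; first lra.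
  by rewrite lerBlDr lerDl exprn_ge0// ltW.
(* [rho] stands for the Jacobian of the branch over [cyl m z], normalised to be a lower bound; one
   value has to serve all [D]. *)
have cylE n m x z : (0 < m)%N -> exists2 rho : R, 0 <= rho &
    forall D, measurable D -> D `<=` cyl m z ->
      rho * Pr D <= Pr (cyl n x `&` iter n T @^-1` D) /\
      Pr (cyl n x `&` iter n T @^-1` D) <=
        expR (2 * K * lambda ^+ m * s n) * (rho * Pr D).
  move=> m0; elim: n x => [|n IH] x.
    exists 1 => // D mD _; rewrite (cyl0 T P) setTI /s big_geq// mulr0 expR0 !mul1r.
    by split.
  have [rho rho0 Hrho] := IH (T x).
  have WE D : cyl n.+1 x `&` iter n.+1 T @^-1` D =
      cyl 1 x `&` iter 1 T @^-1` (cyl n (T x) `&` iter n T @^-1` D).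
    rewrite -add1n cyl_addn -setIA; congr (_ `&` _).
    by apply/seteqP; split => y [h1 h2]; split => //=;
      [rewrite -iterSr|rewrite -iterS iterSr].
  have [A PA Ax] := partition_ex partP x.
  have cA : cyl 1 x = A by exact: cyl1.
  (* Either the branch reaches [cyl m z] and a point [y0] of it supplies a value of [g], or all the
     sets concerned are empty and [rho = 0] will do. *)
  have [[y0 [Ay0 [xy0 zy0]]]|ny] := pselect (exists y0, (cyl 1 x `&`
      iter 1 T @^-1` (cyl n (T x) `&` iter n T @^-1` cyl m z)) y0); last first.
    exists 0 => // D mD Dz; rewrite WE mul0r mulr0 (_ : _ `&` _ = set0) ?pr0//.
    apply/seteqP; split => // y [Ay [h1 h2]]; apply: ny; exists y.
    by split => //; split => //; exact: Dz.
  (* The lower loss [exp (- del)] is put into [rho], so the upper exponent grows by [2 * del], which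
     is the new term of [s]. *)
  pose del := K * lambda ^+ (n + m).+1.
  exists (expR (- del) * g y0 * rho).
    by rewrite !mulr_ge0// ?expR_ge0// ltW.
  move=> D mD Dz; have [h1 h2] := Hrho D mD Dz.
  set D' := cyl n (T x) `&` iter n T @^-1` D in h1 h2 *.
  rewrite WE -/D'; set G := cyl 1 x `&` iter 1 T @^-1` D'.
  have mD' : measurable D'.
    by apply: measurableI; [exact: measurable_cyl|exact: measurable_pre].
  have mG : measurable G.
    by apply: measurableI; [exact: measurable_cyl|exact: measurable_pre].
  have D'sub : D' `<=` cyl (n + m) (T y0).
    rewrite cyl_addn -(cyl_eq partP xy0) -(cyl_eq partP zy0).
    by move=> y [k1 k2]; split => //; exact: Dz.
  have Gsub : G `<=` cyl (n + m).+1 y0.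
    rewrite -add1n cyl_addn -(cyl_eq partP Ay0).
    by move=> y [k1 k2]; split => //; exact: D'sub.
  have TG : T @` G = D'.
    apply/seteqP; split => [y [w [_ Dw] <-]//|y Dy].
    have nm0 : (0 < n + m)%N by rewrite addn_gt0 m0 orbT.
    rewrite cA in Ay0.
    have [w Aw wy] := branch_image PA Ay0 nm0 (D'sub _ Dy).
    by exists w => //; split; rewrite ?cA//= wy.
  have [_] := jac (n + m).+1 y0 G isT mG Gsub; rewrite TG -/del => j1 j2.
  have gd0 : 0 <= g y0 by exact: ltW.
  split.
    apply: le_trans j1; rewrite -!mulrA ler_wpM2l ?expR_ge0//.
    by rewrite ler_wpM2l.
  apply: le_trans j2 _.
  apply: (@le_trans _ _ (expR del * (g y0 *
      (expR (2 * K * lambda ^+ m * s n) * (rho * Pr D))))).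
    by rewrite ler_wpM2l ?expR_ge0// ler_wpM2l.
  have -> : 2 * K * lambda ^+ m * s n.+1 = 2 * K * lambda ^+ m * s n + del + del.
    rewrite /s big_nat_recr//= -/(s n) /del -addSn exprD; ring.
  rewrite [X in _ <= X * _]expRD [X in _ <= X * _ * _]expRD.
  have dd : expR del * expR (- del) = 1 by rewrite -expRD subrr expR0.
  rewrite le_eqVlt; apply/orP; left; apply/eqP.
  set e1 := expR del in dd *; set e2 := expR (- del) in dd *.
  set q := expR _.
  have -> : q * e1 * e1 * (e2 * g y0 * rho * Pr D) =
    (e1 * e2) * (q * e1 * g y0 * rho * Pr D) by ring.
  by rewrite dd; ring.
exists lambda, (2 * K * (lambda / (1 - lambda))); split.
- by rewrite l0.
- by rewrite !mulr_ge0 ?divr_ge0 ?invr_ge0// ltW//; lra.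
move=> n m A z D1 D2 nA m0 mD1 mD2 D1z D2z.
have [E [E1 E2 AE]] := saturated_enum partP (let: And3 cP _ _ := mP in cP) nA.
have mE k : measurable (E k).
  by have [->//|[x -> _]] := E1 k; exact: measurable_cyl.
rewrite [leLHS]mulrC (mulrC (Pr (A `&` iter n T @^-1` D2))) [leRHS]mulrA.
apply: (pr_le_series mE E2 AE) => //.
- exact: measurable_pre.
- exact: measurable_pre.
- exact: pr_ge0.
- by rewrite mulr_ge0 ?expR_ge0 ?pr_ge0.
move=> k; have [->|[x -> _]] := E1 k; first by rewrite !set0I !pr0 !mulr0.
have [rho rho0 H] := cylE n m x z m0.
have [_ up] := H D1 mD1 D1z; have [lo _] := H D2 mD2 D2z.
apply: (@le_trans _ _ (Pr D2 * (expR (2 * K * lambda ^+ m * s n) * (rho * Pr D1)))).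
  by rewrite ler_wpM2l ?pr_ge0.
apply: (@le_trans _ _ (expR (2 * K * lambda ^+ m * s n) * Pr D1 *
    Pr (cyl n x `&` iter n T @^-1` D2))).
  have -> : Pr D2 * (expR (2 * K * lambda ^+ m * s n) * (rho * Pr D1)) =
    expR (2 * K * lambda ^+ m * s n) * Pr D1 * (rho * Pr D2) by ring.
  by rewrite ler_wpM2l// mulr_ge0 ?expR_ge0 ?pr_ge0.
rewrite ler_wpM2r ?pr_ge0// ler_wpM2r ?pr_ge0// ler_expR.
rewrite -[leRHS]mulrA [_ / _ * _]mulrC mulrA ler_wpM2l//.
by rewrite !mulr_ge0// exprn_ge0// ltW.
Qed.

(** For one step, the Jacobian cancels between an upper bound for [Pr (A and T^-1 B)] and a lower
    bound for [Pr A]; the latter is useful because the image of [A] has measure at least [C].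
    Iterated distortion carries this over to longer cylinders. *)
Lemma bounded_correlations : exists2 K : R, 1 <= K &
  forall n A B, saturated T P n A -> measurable B ->
    Pr (A `&` iter n T @^-1` B) <= K * Pr A * Pr B.
Proof.
have [lambda [K [g [l01 K0 g0 jac]]]] := jacobian_distortion.
have [l [c [/andP[/ltW l0 _] c0 dist]]] := bounded_distortion_iter.
case: GM => [[posP _ _] _ [C C0 bigC] _].
have ne A : P A -> A !=set0 by case: partP => _ _; exact.
have CR A : P A -> C <= Pr (T @` A).
  move=> PA; have := bigC A PA; have mA : measurable A by case: mP => _ + _; exact.
  have [x Ax] := ne A PA.
  have [] := jac 1%N x A isT mA; first by rewrite (cyl1 T partP PA Ax).
  by move=> mTA _ _; rewrite (prE mu mTA) lte_fin => /ltW.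
pose K1 := expR (2 * (K * lambda)) / C.
have step A B : P A -> measurable B ->
    Pr (A `&` iter 1 T @^-1` B) <= K1 * Pr A * Pr B.
  move=> PA mB; have mA : measurable A by case: mP => _ + _; exact.
  have [x Ax] := ne A PA.
  have mAB : measurable (A `&` iter 1 T @^-1` B).
    by apply: measurableI => //; exact: measurable_pre.
  have cA : cyl 1 x = A by exact: cyl1.
  have [mTA lo _] : [/\ measurable (T @` A),
          expR (- (K * lambda ^+ 1)) * (g x * Pr (T @` A)) <= Pr A &
          Pr A <= expR (K * lambda ^+ 1) * (g x * Pr (T @` A))].
    by apply: jac => //; rewrite cA.
  have [mTB _ up] : [/\ measurable (T @` (A `&` iter 1 T @^-1` B)),
          expR (- (K * lambda ^+ 1)) * (g x * Pr (T @` (A `&` iter 1 T @^-1` B))) <=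
            Pr (A `&` iter 1 T @^-1` B) &
          Pr (A `&` iter 1 T @^-1` B) <= expR (K * lambda ^+ 1) *
            (g x * Pr (T @` (A `&` iter 1 T @^-1` B)))].
    by apply: jac => //; rewrite cA.
  rewrite expr1 in lo up.
  have up' : Pr (A `&` iter 1 T @^-1` B) <= expR (K * lambda) * (g x * Pr B).
    apply: le_trans up _; rewrite ler_wpM2l ?expR_ge0// ler_wpM2l ?(ltW (g0 x))//.
    by apply: pr_le => // y [w [_ Bw] <-].
  have lo' : expR (- (K * lambda)) * (g x * C) <= Pr A.
    apply: le_trans lo; rewrite ler_wpM2l ?expR_ge0// ler_wpM2l ?(ltW (g0 x))//.
    exact: CR.
  apply: le_trans up' _.
  have -> : expR (K * lambda) * (g x * Pr B) =
      expR (2 * (K * lambda)) / C * (expR (- (K * lambda)) * (g x * C)) * Pr B.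
    have -> : 2 * (K * lambda) = K * lambda + K * lambda by ring.
    rewrite expRD; have dd : expR (K * lambda) * expR (- (K * lambda)) = 1.
      by rewrite -expRD subrr expR0.
    set e1 := expR _ in dd *; set e2 := expR _ in dd *.
    have -> : e1 * e1 / C * (e2 * (g x * C)) * Pr B =
      (e1 * e2) * (e1 * (g x * Pr B)) by field; lra.
    by rewrite dd mul1r.
  rewrite ler_wpM2r ?pr_ge0// ler_wpM2l//.
  by rewrite divr_ge0 ?expR_ge0// ltW.
have K10 : 0 <= K1 by rewrite divr_ge0 ?expR_ge0// ltW.
(* The summand 1 settles the case [n = 0], where the only cylinder is the whole space. *)
pose K2 := 1 + expR (c * l) * K1.
have K21 : 1 <= K2 by rewrite lerDl mulr_ge0 ?expR_ge0.
have K20 : 0 <= K2 by exact: le_trans K21.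
exists K2 => // n A B nA mB.
have [E [E1 E2 AE]] := saturated_enum partP (let: And3 cP _ _ := mP in cP) nA.
have mE k : measurable (E k).
  by have [->//|[x -> _]] := E1 k; exact: measurable_cyl.
rewrite -[leLHS]mul1r mulrAC -[in leRHS](setIT A).
apply: (pr_le_series mE E2 AE) => //.
- exact: measurable_pre.
- by rewrite mulr_ge0 ?pr_ge0.
move=> k; have [->|[x -> _]] := E1 k; first by rewrite !set0I !pr0 !mulr0.
rewrite mul1r setIT; case: n {nA E1} => [|n].
  rewrite (cyl0 T P) setTI prT mulr1 -[leLHS]mul1r.
  by rewrite ler_wpM2r ?pr_ge0.
(* The last symbol [a] is split off: distortion at depth 1 compares the part of [a] sent into [B]
   with [a] itself, and [Pr a > 0] can then be cancelled. *)
have [a Pa ax] := partition_ex partP (iter n T x).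
have ca : cyl 1 (iter n T x) = a by exact: cyl1.
have ma : measurable a by case: mP => _ + _; exact.
have mab : measurable (a `&` iter 1 T @^-1` B).
  by apply: measurableI => //; exact: measurable_pre.
have pa : 0 < Pr a by rewrite -lte_fin -prE//; exact: posP.
have nWa : cyl n.+1 x = cyl n x `&` iter n T @^-1` a.
  by rewrite -addn1 cyl_addn ca.
have nWB : cyl n.+1 x `&` iter n.+1 T @^-1` B =
    cyl n x `&` iter n T @^-1` (a `&` iter 1 T @^-1` B).
  by rewrite nWa -setIA.
have := dist n 1%N (cyl n x) (iter n T x) (a `&` iter 1 T @^-1` B) a
  (@saturated_cyl _ _ T P n x) isT mab ma.
rewrite ca expr1 -nWB -nWa => /(_ (@subIsetl _ _ _) (@subset_refl _ _)) h.
rewrite -(ler_pM2r pa); apply: le_trans h _.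
apply: (@le_trans _ _ (expR (c * l) * (Pr (cyl n.+1 x) * (K1 * Pr a * Pr B)))).
  by rewrite ler_wpM2l ?expR_ge0// ler_wpM2l ?pr_ge0//; exact: step.
have -> : expR (c * l) * (Pr (cyl n.+1 x) * (K1 * Pr a * Pr B)) =
  expR (c * l) * K1 * Pr B * Pr (cyl n.+1 x) * Pr a by ring.
rewrite ler_wpM2r ?pr_ge0// ler_wpM2r ?pr_ge0// ler_wpM2r ?pr_ge0//.
by rewrite lerDr.
Qed.

End distortion.

(** The bookkeeping for the averages: [a] and [b] are [p1] and [p2] up to the mass outside finitely
    many cylinders, [M] is the sum over those cylinders and [S] the full sum. With
    [K ^+ 2 * eta = e / 20] each loss is a small multiple of [e / 20], and their total stays below
    [e]. *)
Lemma average_error {R : realType} (e eta K q n p1 p2 a b M S : R) :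
  0 < e <= 1 -> 0 < eta -> 1 <= K -> K ^+ 2 * eta = e / 20 ->
  1 <= q <= 1 + eta -> 0 <= n -> 0 <= p1 -> 0 <= p2 ->
  (1 - K * eta) * p1 <= a <= p1 -> (1 - K * eta) * p2 <= b <= p2 ->
  M <= q ^+ 2 * (1 + eta) * (n * (a * b)) ->
  (1 - eta) * (n * (a * b)) <= q ^+ 2 * M ->
  0 <= M -> M <= S <= M + n * (2 * (K * (K * eta * (p1 * p2)))) ->
  `|S - n * (p1 * p2)| <= e * (n * (p1 * p2)).
Proof.
move=> /andP[e0 e1] eta0 K1 K2eta /andP[q1 qm] n0 p10 p20 /andP[alo aup]
  /andP[blo bup] mainup mainlo M0 /andP[sumlo sumup].
have K0 : 0 < K by exact: lt_le_trans K1.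
have etaK : eta <= K * eta by rewrite ler_peMl// ltW.
have KetaK : K * eta <= e / 20.
  by rewrite -K2eta expr2 -mulrA ler_peMl// mulr_ge0 ?ltW.
have Ke0 : 0 <= K * eta by rewrite mulr_ge0 ?ltW.
have etae : eta <= e / 20 by exact: le_trans KetaK.
have Ke1 : 0 <= 1 - K * eta by clear - KetaK e1; lra.
have a0 : 0 <= a by apply: le_trans alo; rewrite mulr_ge0.
have b0 : 0 <= b by apply: le_trans blo; rewrite mulr_ge0.
have ab1 : a * b <= p1 * p2 by exact: ler_pM.
have ab2 : (1 - K * eta) ^+ 2 * (p1 * p2) <= a * b.
  have -> : (1 - K * eta) ^+ 2 * (p1 * p2) =
    ((1 - K * eta) * p1) * ((1 - K * eta) * p2) by ring.
  by apply: ler_pM => //; exact: mulr_ge0.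
have ee : eta * eta <= 20^-1 * eta.
  by rewrite ler_wpM2r ?(ltW eta0)//; clear - etae e1 e0; lra.
have q2 : q ^+ 2 <= 1 + 3 * eta.
  have q00 : 0 <= q by exact: le_trans q1.
  have : q ^+ 2 <= (1 + eta) ^+ 2 by rewrite ler_pXn2r// nnegrE (le_trans q00).
  by rewrite [(1 + eta) ^+ 2]expr2; clear - ee eta0; lra.
have q20 : 0 <= q ^+ 2 by exact: sqr_ge0.
set Z := n * (p1 * p2).
have Z0 : 0 <= Z by rewrite mulr_ge0// mulr_ge0.
have U1 : M <= (1 + 3 * eta) * (1 + eta) * Z.
  apply: le_trans mainup _; apply: ler_pM.
  - by rewrite mulr_ge0//; clear - eta0; lra.
  - by rewrite mulr_ge0// mulr_ge0.
  - by rewrite ler_wpM2r//; clear - eta0; lra.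
  - by rewrite ler_wpM2l.
have U2 : n * (2 * (K * (K * eta * (p1 * p2)))) = 2 * (e / 20) * Z.
  by rewrite -K2eta /Z; ring.
have V1 : (1 - eta) * (1 - K * eta) ^+ 2 * Z <= q ^+ 2 * M.
  apply: le_trans mainlo; rewrite -[leLHS]mulrA ler_wpM2l//.
    by clear - etae e1; lra.
  have -> : (1 - K * eta) ^+ 2 * Z = n * ((1 - K * eta) ^+ 2 * (p1 * p2)).
    by rewrite /Z; ring.
  by rewrite ler_wpM2l.
rewrite U2 in sumup.
have etae0 : 0 <= eta * e by rewrite mulr_ge0// ltW.
clear mainup mainlo U2 ab1 ab2 alo aup blo bup a0 b0.
rewrite ler_norml; apply/andP; split.
  have h1 : q ^+ 2 * M <= (1 + 3 * eta) * M by rewrite ler_wpM2r.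
  have h2 : (1 - 3 * (e / 20)) * Z <= (1 - eta) * (1 - K * eta) ^+ 2 * Z.
    rewrite ler_wpM2r//.
    have w1 : 1 - 2 * (e / 20) <= (1 - K * eta) ^+ 2.
      by have := sqr_ge0 (K * eta); rewrite !expr2; clear - KetaK; lra.
    apply: (@le_trans _ _ ((1 - eta) * (1 - 2 * (e / 20)))).
      by clear - etae0 etae; lra.
    by rewrite ler_wpM2l//; clear - etae e1; lra.
  have h3 : (1 - 3 * (e / 20)) * Z <= (1 + 3 * eta) * M.
    by apply: le_trans h2 (le_trans V1 h1).
  have h4 : (1 + 3 * eta) * ((1 - e) * Z) <= (1 - 3 * (e / 20)) * Z.
    by rewrite [leLHS]mulrA ler_wpM2r//; clear - etae0 etae e0; lra.
  have h5 : (1 - e) * Z <= M.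
    rewrite -(@ler_pM2l _ (1 + 3 * eta)); last by clear - eta0; lra.
    exact: le_trans h3.
  by clear - h5 sumlo; lra.
have h1 : (1 + 3 * eta) * (1 + eta) * Z <= (1 + 5 * (e / 20)) * Z.
  by rewrite ler_wpM2r//; clear - ee etae eta0; lra.
have : 0 <= e * Z by rewrite mulr_ge0// ltW.
by clear - h1 U1 sumup; lra.
Qed.

(** * Independence on average for Gibbs-Markov maps *)

Section gibbs_markov_averages.
Context {d : measure_display} {X : measurableType d} {R : realType}.
Variables (mu : probability X R) (T : X -> X) (P : set (set X)).
Hypothesis mP : measurable_partition P.
Hypothesis genP : generating T P.
Hypothesis GM : gibbs_markov mu T P.
Local Notation Pr A := (fine (mu A)).
Local Notation cyl := (cyl T P).

Let muT : measure_preserving mu T. Proof. by case: GM. Qed.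
Let mT : measurable_fun [set: X] T. Proof. by case: muT. Qed.
Let partP : partition P id [set: X]. Proof. by case: mP. Qed.

Lemma iter_gaps n m k x : iter (n + (m + (m + k))) T x =
  iter m T (iter (m + k) T (iter n T x)).
Proof. by rewrite -!iterD; congr iter; lia. Qed.

Lemma sum_pr_disjoint (E : nat -> set X) (H : set X) L :
  (forall k, measurable (E k)) -> measurable H -> trivIset [set: nat] E ->
  \sum_(0 <= i < L) Pr (E i `&` H) = Pr ((\bigcup_(i < L) E i) `&` H).
Proof.
move=> mE mH tE; elim: L => [|L IH].
  by rewrite big_geq// bigcup_mkord big_ord0 set0I pr0.
have mF : measurable (\bigcup_(i < L) E i) by exact: bigcup_measurable.
rewrite big_nat_recr//= IH.
have -> : \bigcup_(i < L.+1) E i = (\bigcup_(i < L) E i) `|` E L.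
  by rewrite !bigcup_mkord big_ord_recr.
have mFL := measurableU _ _ mF (mE L).
rewrite (pr_split mu (measurableI _ _ mFL mH) mF).
congr (fine (mu _) + fine (mu _)); apply/seteqP; split => x.
- by move=> [h1 h2]; split => //; split => //; left.
- by move=> [[_ h2] h1].
- move=> [h1 h2]; split; first by split => //; right.
  move=> [i /= iL Ei]; have := tE i L I I (ex_intro _ x (conj Ei h1)).
  by move=> iE; rewrite iE ltnn in iL.
- by move=> [[[h1|h1] h2] h3] => //; case: h3.
Qed.

(** Distortion is used twice, once to detach the past [A] from [Ei] and once to detach the future
    [B] from [Ej], at the price of a factor [q] each. What remains is the correlation of [Ei] and
    [Ej], whose average is known. *)
Lemma distortion_average (q eta : R) (lambda c : R) (m N : nat)
    (Ei Ej : set X) : 0 < eta <= 1 -> distortion_bound mu T P lambda c ->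
  (0 < m)%N -> q = expR (c * lambda ^+ m) -> measurable Ei -> measurable Ej ->
  (exists z, Ei = cyl m z) -> (exists z, Ej = cyl m z) ->
  0 < Pr Ei -> 0 < Pr Ej ->
  `|\sum_(0 <= k < N) Pr (Ei `&` iter (m + k) T @^-1` Ej) -
     N%:R * (Pr Ei * Pr Ej)| <= N%:R * (eta * (Pr Ei * Pr Ej)) ->
  forall n A B, saturated T P n A -> measurable B ->
    let xi := Pr (A `&` iter n T @^-1` Ei) * Pr (Ej `&` iter m T @^-1` B) in
    let S := \sum_(0 <= k < N) Pr (A `&` iter n T @^-1` (Ei `&`
      iter (m + k) T @^-1` (Ej `&` iter m T @^-1` B))) in
    S <= q ^+ 2 * (1 + eta) * (N%:R * xi) /\
    (1 - eta) * (N%:R * xi) <= q ^+ 2 * S.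
Proof.
move=> /andP[eta0 eta1] dist m0 qE mEi mEj [zi Eiz] [zj Ejz] pi0 pj0 ces n A B nA mB xi S.
have q0 : 0 < q by rewrite qE expR_gt0.
set al := Pr (A `&` iter n T @^-1` Ei) in xi *.
set be := Pr (Ej `&` iter m T @^-1` B) in xi *.
set pi := Pr Ei in pi0 ces *; set pj := Pr Ej in pj0 ces *.
have al0 : 0 <= al by exact: pr_ge0.
have be0 : 0 <= be by exact: pr_ge0.
pose G := Ej `&` iter m T @^-1` B.
have mG : measurable G by apply: measurableI => //; exact: measurable_pre.
pose H k := Ei `&` iter (m + k) T @^-1` G.
have mH k : measurable (H k) by apply: measurableI => //; exact: measurable_pre.
pose x k := Pr (A `&` iter n T @^-1` H k).
pose y k := Pr (Ei `&` iter (m + k) T @^-1` Ej).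
have Hi k : H k `<=` cyl m zi by rewrite -Eiz => w [].
have Gj : G `<=` cyl m zj by rewrite -Ejz => w [].
have ii : Ei `<=` cyl m zi by rewrite -Eiz.
have jj : Ej `<=` cyl m zj by rewrite -Ejz.
have satEi k : saturated T P (m + k) Ei.
  rewrite Eiz; apply: (@saturated_le _ _ T P m); first exact: leq_addr.
  exact: saturated_cyl.
have up k : pi * pj * x k <= q ^+ 2 * (al * be) * y k.
  have h1 := dist n m A zi (H k) Ei nA m0 (mH k) mEi (Hi k) ii.
  have h2 := dist (m + k)%N m Ei zj G Ej (satEi k) m0 mG mEj Gj jj.
  rewrite -qE in h1 h2.
  apply: (@le_trans _ _ (pj * (q * (al * Pr (H k))))).
    by rewrite mulrAC mulrC ler_wpM2l ?(ltW pj0)// mulrC.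
  apply: (@le_trans _ _ (q * al * (q * (y k * be)))); last first.
    by rewrite le_eqVlt; apply/orP; left; apply/eqP; ring.
  have -> : pj * (q * (al * Pr (H k))) = q * al * (Pr (H k) * pj) by ring.
  by rewrite ler_wpM2l// mulr_ge0// ltW.
have lo k : al * be * y k <= q ^+ 2 * (pi * pj * x k).
  have h1 := dist n m A zi Ei (H k) nA m0 mEi (mH k) ii (Hi k).
  have h2 := dist (m + k)%N m Ei zj Ej G (satEi k) m0 mEj mG jj Gj.
  rewrite -qE in h1 h2.
  apply: (@le_trans _ _ (al * (q * (Pr (H k) * pj)))).
    by rewrite -mulrA ler_wpM2l// mulrC.
  have -> : al * (q * (Pr (H k) * pj)) = q * pj * (al * Pr (H k)) by ring.
  apply: (@le_trans _ _ (q * pj * (q * (x k * pi)))).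
    by rewrite ler_wpM2l// mulr_ge0// ltW.
  by rewrite le_eqVlt; apply/orP; left; apply/eqP; ring.
have pij : 0 < pi * pj by rewrite mulr_gt0.
have SE : S = \sum_(0 <= k < N) x k by [].
move: ces; rewrite -/(\sum_(0 <= k < N) y k); set Y := \sum_(0 <= k < N) _.
rewrite ler_norml => /andP[ces1 ces2].
have Sup : pi * pj * S <= q ^+ 2 * (al * be) * Y.
  by rewrite SE !mulr_sumr; apply: ler_sum => k _; exact: up.
have Slo : al * be * Y <= q ^+ 2 * (pi * pj * S).
  by rewrite SE !mulr_sumr; apply: ler_sum => k _; exact: lo.
have Y1 : Y <= (1 + eta) * N%:R * (pi * pj) by lra.
have Y2 : (1 - eta) * N%:R * (pi * pj) <= Y by lra.
split; rewrite -(ler_pM2l pij).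
  apply: le_trans Sup _.
  apply: (@le_trans _ _ (q ^+ 2 * (al * be) * ((1 + eta) * N%:R * (pi * pj)))).
    by rewrite ler_wpM2l// mulr_ge0 ?exprn_ge0 ?mulr_ge0// ltW.
  by rewrite le_eqVlt; apply/orP; left; apply/eqP; rewrite /xi; ring.
apply: (@le_trans _ _ (al * be * ((1 - eta) * N%:R * (pi * pj)))).
  by rewrite le_eqVlt; apply/orP; left; apply/eqP; rewrite /xi; ring.
apply: (@le_trans _ _ (al * be * Y)); first by rewrite ler_wpM2l// mulr_ge0.
by apply: le_trans Slo _; rewrite le_eqVlt; apply/orP; left; apply/eqP; ring.
Qed.

Hypothesis ergT : ergodic mu T.

(* The window [N] and the gap [2 * m] depend on [e] only, not on [n], [A], [B]. *)
Lemma gibbs_markov_average (e : R) : 0 < e -> exists m N : nat,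
  [/\ (0 < m)%N, (0 < N)%N & forall n A B, saturated T P n A -> measurable B ->
    `|\sum_(0 <= k < N) Pr (A `&` iter (n + (m + (m + k))) T @^-1` B) -
      N%:R * (Pr A * Pr B)| <= e * (N%:R * (Pr A * Pr B))].
Proof.
move=> e0; have [lambda [c [/andP[l0 l1] c0 dist]]] := bounded_distortion_iter mP genP GM.
have [K K1 corr] := bounded_correlations mP genP GM.
have K0 : 0 < K by exact: lt_le_trans K1.
pose e' := Num.min e 1.
have e'0 : 0 < e' by rewrite lt_min e0 ltr01.
have e'e : e' <= e by rewrite ge_min lexx.
have e'1 : e' <= 1 by rewrite ge_min lexx orbT.
(* Bounded correlations are applied twice to the discarded part, whence the division by [K ^+ 2]. *)
pose eta := e' / 20 / K ^+ 2.
have eta0 : 0 < eta by rewrite !divr_gt0 ?exprn_gt0.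
have K2eta : K ^+ 2 * eta = e' / 20 by rewrite mulrC divfK// gt_eqF// exprn_gt0.
have etaK : eta <= K * eta by rewrite ler_peMl// ltW.
have KetaK : K * eta <= e' / 20.
  by rewrite -K2eta expr2 -mulrA ler_peMl// mulr_ge0 ?ltW.
have eta1 : eta <= 20^-1.
  apply: le_trans etaK (le_trans KetaK _); lra.
have eta01 : 0 < eta <= 1 by rewrite eta0/=; lra.
have [m m0 qm] : exists2 m, (0 < m)%N & expR (c * lambda ^+ m) <= 1 + eta.
  have ln0 : 0 < ln (1 + eta) by rewrite ln_gt0// ltrDl.
  have l1' : `|lambda| < 1 by rewrite ger0_norm// ltW.
  have /cvgr0Pnorm_le := cvg_expr l1'.
  have c10 : 0 < ln (1 + eta) / (c + 1) by rewrite divr_gt0//; lra.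
  move=> /(_ _ c10)[m _ Hm]; exists m.+1 => //.
  have := Hm m.+1 (leqnSn m); rewrite /= ger0_norm ?exprn_ge0 ?(ltW l0)// => h.
  rewrite -[leRHS]lnK ?posrE ?ler_expR; last by lra.
  apply: (@le_trans _ _ (c * (ln (1 + eta) / (c + 1)))); first by rewrite ler_wpM2l.
  by rewrite mulrCA ler_piMr ?(ltW ln0)// ler_pdivrMr; lra.
set q := expR (c * lambda ^+ m) in qm.
have q1 : 1 <= q by rewrite -expR0 ler_expR mulr_ge0// exprn_ge0// ltW.
have [E [E1 E2 E3]] := cylinder_enum T partP (let: And3 cP _ _ := mP in cP) m.
have mE k : measurable (E k).
  have [->//|[x ->]] := E1 k; exact: (measurable_sat muT mP (@saturated_cyl _ _ T P m x)).
have satE k : saturated T P m (E k).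
  by have [->//|[x ->]] := E1 k; exact: saturated_cyl.
pose F L := \bigcup_(i < L) E i.
have mF L : measurable (F L) by exact: bigcup_measurable.
have satF L : saturated T P m (F L) by exact: saturated_bigcup.
(* Finitely many [m]-cylinders carry all but [eta] of the mass, so one window [N] can serve all
   their pairs. *)
have [L FL] : exists L, Pr (~` F L) <= eta.
  have Fcvg : mu (F L) @[L --> \oo] --> 1%E.
    have <- : mu (\bigcup_L F L) = 1%E.
      rewrite -(@probability_setT _ _ _ mu); congr (mu _).
      rewrite -E3; apply/seteqP; split => x [L _].
        by move=> [i _ Ei]; exists i.
      by move=> EL; exists L.+1 => //; exists L => //=.
    apply: nondecreasing_cvg_mu => //; first exact: bigcupT_measurable.
    move=> i j ij; apply/subsetPset => x [k /= ki Ek]; exists k => //=.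
    exact: leq_trans ij.
  move: Fcvg => /fine_cvgP[_ /cvgrPdist_le /(_ _ eta0)[L _ /(_ L (leqnn L)) /= h]].
  exists L; rewrite prC//; exact: le_trans (ler_norm _) h.
pose V := ~` F L.
have mV : measurable V by exact: measurableC.
have satV : saturated T P m V by exact: saturatedC.
have nearN : \forall N \near \oo, forall i j : 'I_L,
    `|\sum_(0 <= k < N) Pr (E i `&` iter (m + k) T @^-1` E j) -
       N%:R * (Pr (E i) * Pr (E j))| <= N%:R * (eta * (Pr (E i) * Pr (E j))).
  apply: filter_forall => i; apply: filter_forall => j.
  (* The error is to be relative to the product; if that is zero, [cesaro_mixing], which needs a
     positive error, does not apply, but all the terms vanish. *)
  have [z|] := eqVneq (Pr (E i) * Pr (E j)) 0.
    apply: nearW => N; rewrite z !mulr0 subr0 big1 ?normr0// => k _.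
    have mI : measurable (E i `&` iter (m + k) T @^-1` E j).
      by apply: measurableI => //; exact: measurable_pre.
    apply/eqP; rewrite eq_le pr_ge0 andbT.
    move/eqP: z; rewrite mulf_eq0 => /orP[] /eqP <-.
      by apply: pr_le.
    by rewrite -(pr_pre muT (m + k) (mE j)); apply: pr_le => //; exact: measurable_pre.
  move=> nz; have pp : 0 < eta * (Pr (E i) * Pr (E j)).
    by rewrite mulr_gt0// lt_neqAle eq_sym nz mulr_ge0 ?pr_ge0.
  have mEj := measurable_pre mT m (mE j).
  have := cesaro_mixing muT ergT (mE i) mEj pp; apply: filterS => N.
  rewrite pr_pre//; congr (`|_ - _| <= _); apply: eq_bigr => k _.
  by congr (Pr (_ `&` _)); apply/seteqP; split => x /=; rewrite iterD.
have [N N0 HN] : exists2 N, (0 < N)%N & forall i j : 'I_L,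
    `|\sum_(0 <= k < N) Pr (E i `&` iter (m + k) T @^-1` E j) -
       N%:R * (Pr (E i) * Pr (E j))| <= N%:R * (eta * (Pr (E i) * Pr (E j))).
  by case: nearN => N _ HN; exists N.+1 => //; apply: HN => /=.
exists m, N; split => // n A B nA mB.
have mA := measurable_sat muT mP nA.
have mpB k := measurable_pre mT k mB.
have NR : 0 < N%:R :> R by rewrite ltr0n.
set pA := Pr A; set pB := Pr B.
have pA0 : 0 <= pA by exact: pr_ge0.
have pB0 : 0 <= pB by exact: pr_ge0.
have pAB0 : 0 <= N%:R * (pA * pB) by rewrite mulr_ge0// mulr_ge0.
pose term k := Pr (A `&` iter (n + (m + (m + k))) T @^-1` B).
pose main k := Pr (A `&` iter n T @^-1` (F L `&`
  iter (m + k) T @^-1` (F L `&` iter m T @^-1` B))).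
pose G j := E j `&` iter m T @^-1` B.
have mG j : measurable (G j) by exact: measurableI.
have mFB : measurable (F L `&` iter m T @^-1` B) by exact: measurableI.
have mpk S k : measurable S -> measurable (iter k T @^-1` S).
  by move=> mS; exact: measurable_pre.
pose Sij i j := \sum_(0 <= k < N) Pr (A `&` iter n T @^-1` (E i `&`
      iter (m + k) T @^-1` (E j `&` iter m T @^-1` B))).
pose al i := Pr (A `&` iter n T @^-1` E i).
pose be j := Pr (E j `&` iter m T @^-1` B).
have Sbound i j : (i < L)%N -> (j < L)%N ->
    Sij i j <= q ^+ 2 * (1 + eta) * (N%:R * (al i * be j)) /\
    (1 - eta) * (N%:R * (al i * be j)) <= q ^+ 2 * Sij i j.
  move=> iL jL.
  have [z|nz] := eqVneq (Pr (E i) * Pr (E j)) 0.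
    have S0 : Sij i j = 0.
      rewrite /Sij big1// => k _.
      apply/eqP; rewrite eq_le pr_ge0 andbT.
      have mI : measurable (A `&` iter n T @^-1` (E i `&` iter (m + k) T @^-1` G j)).
        by apply: measurableI => //; apply: (mpk); apply: measurableI => //; exact: mpk.
      move/eqP: z; rewrite mulf_eq0 => /orP[] /eqP <-.
        rewrite -(pr_pre muT n (mE i)); apply: pr_le => //; first exact: mpk.
        by move=> x [_ []].
      rewrite -(pr_pre muT (n + (m + k)) (mE j)); apply: pr_le => //; first exact: mpk.
      by move=> x [_ [_ [Ej _]]]; rewrite /= addnC iterD.
    have ab0 : al i * be j = 0.
      apply/eqP; rewrite mulf_eq0; move/eqP: z; rewrite mulf_eq0 => /orP[] /eqP z.
        apply/orP; left; rewrite eq_le pr_ge0 andbT -z -(pr_pre muT n (mE i)).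
        by apply: pr_le => //; [apply: measurableI => //; exact: mpk|exact: mpk].
      by apply/orP; right; rewrite eq_le pr_ge0 andbT -z; apply: pr_le => //; exact: mG.
    by rewrite S0 ab0 !mulr0.
  have [[pi0 pj0]] : 0 < Pr (E i) /\ 0 < Pr (E j).
    move: nz; rewrite mulf_eq0 negb_or => /andP[z1 z2].
    by rewrite !lt_neqAle eq_sym z1 [_ == _ in X in _ /\ X]eq_sym z2 !pr_ge0.
  have [Ei0|Eiz] := E1 i; first by rewrite Ei0 pr0 ltxx in pi0.
  have [Ej0|Ejz] := E1 j; first by rewrite Ej0 pr0 ltxx in pj0.
  exact: (distortion_average eta01 dist m0 erefl (mE i) (mE j) Eiz Ejz pi0 pj0
    (HN (Ordinal iL) (Ordinal jL)) nA mB).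
have mainE : \sum_(0 <= k < N) main k =
    \sum_(0 <= i < L) \sum_(0 <= j < L) Sij i j.
  rewrite /Sij; under [RHS]eq_bigr do rewrite exchange_big/=.
  rewrite exchange_big/=; apply: eq_bigr => k _.
  have tpre p : trivIset [set: nat] (fun i => iter p T @^-1` E i).
    by move=> i j _ _ [x [xi xj]]; apply: E2 => //; exists (iter p T x).
  have step p (H Q : set X) : measurable H -> measurable Q ->
      \sum_(0 <= i < L) Pr (H `&` iter p T @^-1` (E i `&` Q)) =
      Pr (H `&` iter p T @^-1` (F L `&` Q)).
    move=> mH mQ.
    have Z (W : set X) : H `&` iter p T @^-1` (W `&` Q) =
        iter p T @^-1` W `&` (H `&` iter p T @^-1` Q).
      by apply/seteqP; split => x [h1 [h2 h3]].
    under eq_bigr do rewrite Z.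
    rewrite (sum_pr_disjoint L (E := fun i => iter p T @^-1` E i))//.
    - by rewrite Z /F preimage_bigcup.
    - by move=> i; exact: mpk.
    - by apply: measurableI => //; exact: mpk.
  under eq_bigr => i _.
    have Z (W : set X) : A `&` iter n T @^-1` (E i `&` iter (m + k) T @^-1` W) =
        (A `&` iter n T @^-1` E i) `&` iter (n + (m + k)) T @^-1` W.
      apply/seteqP; split => x.
        by move=> [h1 [h2 h3]]; split; [split|rewrite /= addnC iterD].
      by move=> [[h1 h2]]; rewrite /= addnC iterD => h3; split.
    under eq_bigr do rewrite Z.
    rewrite step//; last by apply: measurableI => //; exact: mpk.
    rewrite -Z.
    over.
  by rewrite step//; exact: mpk.
have alE : \sum_(0 <= i < L) al i = Pr (A `&` iter n T @^-1` F L).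
  have tpre : trivIset [set: nat] (fun i => iter n T @^-1` E i).
    by move=> i j _ _ [x [xi xj]]; apply: E2 => //; exists (iter n T x).
  rewrite [A `&` _]setIC /F preimage_bigcup -sum_pr_disjoint//.
    by apply: eq_bigr => i _; rewrite /al setIC.
  by move=> i; exact: mpk.
have beE : \sum_(0 <= j < L) be j = Pr (F L `&` iter m T @^-1` B).
  by rewrite sum_pr_disjoint.
have abE : \sum_(0 <= i < L) \sum_(0 <= j < L) N%:R * (al i * be j) =
    N%:R * (Pr (A `&` iter n T @^-1` F L) * Pr (F L `&` iter m T @^-1` B)).
  rewrite -alE -beE mulr_suml mulr_sumr; apply: eq_bigr => i _.
  by rewrite !mulr_sumr.
have mainup : \sum_(0 <= k < N) main k <= q ^+ 2 * (1 + eta) * (N%:R *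
    (Pr (A `&` iter n T @^-1` F L) * Pr (F L `&` iter m T @^-1` B))).
  rewrite mainE -abE mulr_sumr big_nat [leRHS]big_nat; apply: ler_sum => i /andP[_ iL].
  rewrite mulr_sumr big_nat [leRHS]big_nat; apply: ler_sum => j /andP[_ jL].
  by have [] := Sbound i j iL jL.
have mainlo : (1 - eta) * (N%:R *
    (Pr (A `&` iter n T @^-1` F L) * Pr (F L `&` iter m T @^-1` B))) <=
    q ^+ 2 * \sum_(0 <= k < N) main k.
  rewrite mainE -abE !mulr_sumr big_nat [leRHS]big_nat; apply: ler_sum => i /andP[_ iL].
  rewrite !mulr_sumr big_nat [leRHS]big_nat; apply: ler_sum => j /andP[_ jL].
  by have [] := Sbound i j iL jL.
have mAF : measurable (A `&` iter n T @^-1` F L).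
  by apply: measurableI => //; exact: mpk.
have mVB k : measurable (V `&` iter k T @^-1` B) by exact: measurableI.
have VB k : (m <= k)%N -> Pr (V `&` iter k T @^-1` B) <= K * eta * pB.
  move=> mk; have satVk : saturated T P k V by exact: saturated_le mk satV.
  apply: le_trans (corr _ _ _ satVk mB) _.
  by rewrite ler_wpM2r// ler_wpM2l// ltW.
have AFup : Pr (A `&` iter n T @^-1` F L) <= pA by apply: pr_le.
have FBup : Pr (F L `&` iter m T @^-1` B) <= pB.
  by rewrite /pB -(pr_pre muT m mB); apply: pr_le.
have AFlo : (1 - K * eta) * pA <= Pr (A `&` iter n T @^-1` F L).
  have h := pr_split mu mA (mpk _ n (mF L)).
  rewrite preimage_setC -/V -/pA in h.
  have h2 : Pr (A `&` iter n T @^-1` V) <= K * pA * eta.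
    by apply: le_trans (corr _ _ _ nA mV) _; rewrite ler_wpM2l// mulr_ge0// ltW.
  by clear - h h2; lra.
have FBlo : (1 - K * eta) * pB <= Pr (F L `&` iter m T @^-1` B).
  have := pr_split mu (mpB m) (mF L); rewrite pr_pre// -/pB.
  rewrite setIC [iter m T @^-1` B `&` ~` _]setIC -/V => h.
  have := VB m (leqnn m); clear - h; lra.
(* A point lost from [main] lies in [V] at time [n] or at time [n + (m + k)]. Either event has a
   bound proportional to [pA * pB], by separating [V] from [B] and then [A] from both. *)
have termup k : term k <= main k + 2 * (K * (K * eta * (pA * pB))).
  have mW : measurable (A `&` iter (n + (m + k)) T @^-1` (V `&` iter m T @^-1` B)).
    by apply: measurableI => //; exact: mpk.
  have mY : measurable (A `&` iter n T @^-1` (V `&` iter (m + (m + k)) T @^-1` B)).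
    by apply: measurableI => //; exact: mpk.
  have mM : measurable (A `&` iter n T @^-1` (F L `&`
      iter (m + k) T @^-1` (F L `&` iter m T @^-1` B))).
    by apply: measurableI => //; apply: (mpk); apply: measurableI => //; exact: mpk.
  have W : Pr (A `&` iter (n + (m + k)) T @^-1` (V `&` iter m T @^-1` B)) <=
      K * (K * eta * (pA * pB)).
    have satA' : saturated T P (n + (m + k)) A by apply: saturated_le nA; exact: leq_addr.
    apply: le_trans (corr _ _ _ satA' (mVB m)) _.
    have -> : K * (K * eta * (pA * pB)) = K * pA * (K * eta * pB) by ring.
    by rewrite ler_wpM2l ?VB// mulr_ge0// ltW.
  have Y : Pr (A `&` iter n T @^-1` (V `&` iter (m + (m + k)) T @^-1` B)) <=
      K * (K * eta * (pA * pB)).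
    apply: le_trans (corr _ _ _ nA (mVB _)) _.
    have -> : K * (K * eta * (pA * pB)) = K * pA * (K * eta * pB) by ring.
    by rewrite ler_wpM2l ?VB ?leq_addr// mulr_ge0// ltW.
  have sub : A `&` iter (n + (m + (m + k))) T @^-1` B `<=`
      (A `&` iter n T @^-1` (F L `&` iter (m + k) T @^-1` (F L `&` iter m T @^-1` B)))
      `|` ((A `&` iter n T @^-1` (V `&` iter (m + (m + k)) T @^-1` B)) `|`
          (A `&` iter (n + (m + k)) T @^-1` (V `&` iter m T @^-1` B))).
    move=> x [Ax Bx].
    have Bn : (iter (m + (m + k)) T @^-1` B) (iter n T x) by rewrite /= -iterD addnC.
    have Bm : (iter m T @^-1` B) (iter (m + k) T (iter n T x)).
      by rewrite /= -iter_gaps.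
    have [Fn|Vn] := pselect (F L (iter n T x)); last by right; left.
    have [Fm|Vm] := pselect (F L (iter (m + k) T (iter n T x))); first by left.
    by right; right; split => //=; rewrite addnC iterD.
  apply: le_trans (pr_le mu _ _ sub) _.
  - by apply: measurableI => //; exact: mpk.
  - by apply: measurableU => //; exact: measurableU.
  apply: le_trans (pr_setU_le mu mM (measurableU _ _ mY mW)) _.
  rewrite -/(main k) lerD2l; apply: le_trans (pr_setU_le mu mY mW) _; lra.
have termlo k : main k <= term k.
  apply: pr_le.
  - by apply: measurableI => //; apply: (mpk); apply: measurableI => //; exact: mpk.
  - by apply: measurableI => //; exact: mpk.
  move=> x [Ax [_ [_ Bx]]]; split => //.
  by rewrite /= iter_gaps.
have sumup : \sum_(0 <= k < N) term k <= \sum_(0 <= k < N) main k +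
    N%:R * (2 * (K * (K * eta * (pA * pB)))).
  rewrite mulr_natl -[X in _ *+ X]subn0 -sumr_const_nat -big_split/=.
  by apply: ler_sum => k _; exact: termup.
have sumlo : \sum_(0 <= k < N) main k <= \sum_(0 <= k < N) term k.
  by apply: ler_sum => k _; exact: termlo.
rewrite -/(\sum_(0 <= k < N) term k).
have M0 : 0 <= \sum_(0 <= k < N) main k by apply: sumr_ge0 => k _; exact: pr_ge0.
apply: (@le_trans _ _ (e' * (N%:R * (pA * pB)))); last by rewrite ler_wpM2r.
by apply: (average_error _ eta0 K1 K2eta _ _ pA0 pB0 _ _ mainup mainlo M0 _);
  rewrite ?e'0 ?e'1 ?q1 ?qm ?ler0n ?AFlo ?AFup ?FBlo ?FBup ?sumlo ?sumup.
Qed.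

End gibbs_markov_averages.

(** * Escape rates of Gibbs-Markov maps *)

Section gibbs_markov_rates.
Context {d : measure_display} {X : measurableType d} {R : realType}.
Variables (mu : probability X R) (T : X -> X) (P : set (set X)).
Hypothesis mP : measurable_partition P.
Hypothesis genP : generating T P.
Hypothesis GM : gibbs_markov mu T P.
Local Notation Pr A := (fine (mu A)).

Let muT : measure_preserving mu T. Proof. by case: GM. Qed.
Let mT : measurable_fun [set: X] T. Proof. by case: muT. Qed.
Let partP : partition P id [set: X]. Proof. by case: mP. Qed.

Lemma localized_rates_of_gibbs_markov (U : nat -> set X) : ergodic mu T ->
  good_neighborhood_system mu T P U ->
  (essential_period mu T (U n) @[n --> \oo] --> +oo)%E ->
  [/\ (lower_escape_rate mu T (U n) / mu (U n))%E @[n --> \oo] --> 1%E,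
      (upper_escape_rate mu T (U n) / mu (U n))%E @[n --> \oo] --> 1%E &
      (\forall n \near \oo, cvgn (escape_seq mu T (U n))) ->
        (escape_rate mu T (U n) / mu (U n))%E @[n --> \oo] --> 1%E].
Proof.
move=> ergT goodU periodU.
have [K K1 corr] := bounded_correlations mP genP GM.
have K0 : 0 <= K by exact: le_trans K1.
have satcorr i j A B : saturated T P i A -> (i <= j)%N -> measurable B ->
    Pr (A `&` iter j T @^-1` B) <= K * Pr A * Pr B.
  by move=> iA ij mB; apply: corr => //; exact: saturated_le iA.
have QI : quasi_independent mu T P K (fun=> 0).
  move=> i j m A B iA mB ij; rewrite addr0.
  by apply: satcorr ij _ => //; exact: (measurable_sat muT mP mB).
apply: (localized_rates_of_quasi_independence muT mP goodU periodU QI K0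
  (K2 := K) (C2 := 0) (p2 := 2)) => //.
  by rewrite ltr1n.
move=> e e0.
have [kappa [_ satU ksmall _]] := good_neighborhoods muT mP goodU.
have [m [N [m0 N0 avg]]] := gibbs_markov_average mP genP GM ergT e0.
have D0 : 0 < (m + m + N)%:R :> R by rewrite ltr0n addn_gt0 N0 orbT.
have e2 : 0 < e / 2 by rewrite divr_gt0.
(* Half of the budget pays for [kappa n]; the other half pays for [m + m + N], which is fixed before
   [n]. *)
have H1 := ksmall _ e2.
have H2 := ksmall _ (divr_gt0 e2 D0).
near=> n.
have [ku _] : (kappa n)%:R * Pr (U n) <= e / 2 /\ Pr (U n) <= e / 2 by near: n.
have [_ us] : (kappa n)%:R * Pr (U n) <= e / 2 / (m + m + N)%:R /\
  Pr (U n) <= e / 2 / (m + m + N)%:R by near: n.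
exists (kappa n + (m + m))%N, N; split => //.
- by rewrite !addn_gt0 m0 !orbT.
- rewrite -addnA natrD mulrDl.
  move: us; rewrite ler_pdivlMr// mulrC => us; lra.
- move=> r; have mS := measurable_survivors r mT (measurable_sat muT mP (satU n)).
  rewrite (eq_bigr (fun k => Pr (U n `&`
    iter (kappa n + (m + (m + k))) T @^-1` survivors T (U n) r))).
    exact: avg.
  by move=> k _; rewrite -!addnA.
- move=> q r cq.
  have mS := measurable_survivors r mT (measurable_sat muT mP (satU n)).
  rewrite mulrA; apply: (satcorr (kappa n)) => //.
  by apply: leq_trans cq; exact: leq_addr.
Unshelve. all: by end_near. Qed.

(** Surviving [t] steps is an event of the first [k + t] symbols, so bounded correlations separate
    it from survival that starts at time [k + t]; the window of length [k] in between is dropped. *)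
Lemma survivors_submultiplicative (U : set X) k : saturated T P k U ->
  exists2 K : R, 1 <= K & forall t r,
    Pr (survivors T U (k + t + r)) <=
    K * Pr (survivors T U t) * Pr (survivors T U r).
Proof.
move=> kU; have [K K1 corr] := bounded_correlations mP genP GM.
have mU := measurable_sat muT mP kU.
have mS t := measurable_survivors t mT mU.
exists K => // t r.
apply: le_trans (corr _ _ _ (saturated_survivors partP kU (t := t)) (mS r)).
apply: pr_le => //; first by apply: measurableI => //; exact: measurable_pre.
move=> x Sx; split; last exact: survivors_sub Sx.
by move=> j jt; apply: Sx; rewrite -addnA ltn_addl// ltn_addr.
Qed.

End gibbs_markov_rates.

(** * Existence of escape rates by subadditivity *)

Section fekete.
Context {R : realType}.

(* Fekete's lemma with a gap [k] and a defect [K]; the limit of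
   [- ln (a t) / t] may be infinite. *)
Lemma submultiplicative_rate_cvg (a : nat -> R) (K : R) k :
  (forall t, 0 <= a t <= 1) -> (forall t, a t.+1 <= a t) -> 1 <= K ->
  (forall t r, a (k + t + r)%N <= K * a t * a r) ->
  cvgn (fun t : nat => ((t%:R^-1 : R)%:E * `|lne (a t)%:E|)%E).
Proof.
move=> a01 adec K1 asub; set v := fun t : nat => _.
have a_le m n : (m <= n)%N -> a n <= a m.
  by move=> /subnK <-; elim: (n - m)%N => // i IH; exact: le_trans (adec _) IH.
have [[t0 a0]|apos] := pselect (exists t, a t = 0).
  have C : (fun _ : nat => +oo%E : \bar R) @ \oo --> (+oo%E : \bar R) by exact: cvg_cst.
  apply/cvg_ex; exists +oo%E; apply: cvg_trans C; apply: near_eq_cvg; near=> t.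
  have t1 : (0 < t)%N by near: t; exists 1%N.
  have at0 : a t = 0.
    apply/eqP; rewrite eq_le; have /andP[-> _] := a01 t; rewrite andbT -a0.
    by apply: a_le; near: t; exists t0.
  by rewrite /v at0 le0_lneNy//= gt0_muley// lte_fin invr_gt0 ltr0n.
have {}apos t : 0 < a t.
  have /andP[a0 _] := a01 t; rewrite lt_neqAle a0 andbT eq_sym.
  by apply/eqP => at0; apply: apos; exists t.
pose c t := - ln (a t); pose M := ln K.
have K0 : 0 < K by exact: lt_le_trans K1.
have M0 : 0 <= M by exact: ln_ge0.
have c0 t : 0 <= c t by rewrite oppr_ge0; apply: ln_le0; case/andP: (a01 t).
have c_le m n : (m <= n)%N -> c m <= c n.
  by move=> mn; rewrite lerN2 ler_ln ?posrE//; exact: a_le.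
have csup t r : c t + c r - M <= c (k + t + r)%N.
  have := asub t r; rewrite -ler_ln ?posrE ?mulr_gt0//.
  by rewrite !lnM ?posrE ?mulr_gt0// /c /M => h; lra.
have vE t : v t = (t%:R^-1 * c t)%:E.
  by rewrite /v lne_EFin// abse_EFin ler0_norm -?EFinM// -oppr_ge0; exact: c0.
(* Each block of length [k + s] raises [c] by at least [c s - M]; the limit is the supremum of these
   slopes. *)
pose rate s := (c s - M) / (k + s)%:R.
pose l := ereal_sup [set (rate s)%:E | s in [set s | (0 < s)%N]].
have lower s (x : R) : (0 < s)%N -> x < rate s ->
    \forall t \near \oo, x <= t%:R^-1 * c t.
  move=> s0 xs; set p := (k + s)%N.
  have p0 : (0 < p)%N by rewrite addn_gt0 s0 orbT.
  have pR : 0 < p%:R :> R by rewrite ltr0n.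
  have [f0|f0] := leP (c s - M) 0.
    apply: nearW => t; apply: (@le_trans _ _ 0); last by rewrite mulr_ge0.
    by rewrite ltW// (lt_le_trans xs)// /rate -/p pmulr_lle0// invr_gt0.
  have mult q : q%:R * (c s - M) <= c (q * p)%N.
    elim: q => [|q IH]; first by rewrite mul0r.
    have := csup s (q * p)%N; rewrite -/p mulSn -natr1 mulrDl mul1r; lra.
  have gap : 0 < rate s - x by rewrite subr_gt0.
  near=> t.
  have t1 : 0 < t%:R :> R by rewrite ltr0n; near: t; exists 1%N.
  have tbig : (c s - M) / (rate s - x) <= t%:R by near: t; exact: nbhs_infty_ger.
  rewrite ler_pdivlMl//.
  have h1 : (t %/ p)%:R * (c s - M) <= c t.
    by apply: le_trans (mult _) _; apply: c_le; exact: leq_trunc_div.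
  have h2 : t%:R <= ((t %/ p)%:R + 1) * p%:R :> R.
    by rewrite natr1 -natrM ler_nat ltnW// ltn_ceil.
  have h3 : t%:R * rate s <= (t %/ p)%:R * (c s - M) + (c s - M).
    rewrite /rate -/p mulrA ler_pdivrMr//.
    have -> : ((t %/ p)%:R * (c s - M) + (c s - M)) * p%:R =
      ((t %/ p)%:R + 1) * p%:R * (c s - M) by ring.
    by rewrite ler_wpM2r// ltW.
  move: tbig; rewrite ler_pdivrMr//; lra.
(* Conversely the slope of [t] itself is below the supremum, and division by [t] makes [k] and [M]
   disappear. *)
have upper t (r : R) : (0 < t)%N -> (l <= r%:E)%E ->
    c t <= r * (k + t)%:R + M.
  move=> t0 lr; have : ((rate t)%:E <= l)%E.
    by apply: ereal_sup_ubound; exists t.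
  move=> /le_trans/(_ lr); rewrite lee_fin ler_pdivrMr ?ltr0n ?addn_gt0 ?t0 ?orbT//.
  lra.
apply/cvg_ex; exists l.
rewrite (_ : v = fun t => (t%:R^-1 * c t)%:E); last exact/funext.
have approx (x : R) : (x%:E < l)%E -> \forall t \near \oo, x <= t%:R^-1 * c t.
  move=> xl; have [_ [s s0 <-]] := ereal_sup_gt xl.
  by rewrite lte_fin; exact: lower.
have lN : l != -oo%E.
  rewrite gt_eqF//; apply: (@lt_le_trans _ _ (rate 1%N)%:E); first exact: ltNyr.
  by apply: ereal_sup_ubound; exists 1%N.
case lE : l lN => [r| |] // _; last first.
  apply/cvgeyPge => x.
  have := approx x; rewrite lE ltry => /(_ isT); apply: filterS => t.
  by rewrite lee_fin.
apply: cvg_EFin; first by exact: nearW.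
apply/cvgrPdist_le => e e0.
have H1 : \forall t \near \oo, r - e <= t%:R^-1 * c t.
  by apply: approx; rewrite lE lte_fin; lra.
near=> t.
have t1 : 0 < t%:R :> R by rewrite ltr0n; near: t; exists 1%N.
have lo : r - e <= t%:R^-1 * c t by near: t.
have big : (r * k%:R + M) / e <= t%:R by near: t; exact: nbhs_infty_ger.
rewrite ler_distlC; apply/andP; split; first exact: lo.
rewrite ler_pdivrMl//; have := upper t r; rewrite lE lexx -(ltr0n R) t1 natrD.
move=> /(_ isT isT); move: big; rewrite ler_pdivrMr//; lra.
Unshelve. all: by end_near. Qed.

End fekete.

Lemma gibbs_markov_escape_cvg {d : measure_display} {X : measurableType d}
    {R : realType} (mu : probability X R) (T : X -> X) (P : set (set X))
    (mP : measurable_partition P) (genP : generating T P)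
    (GM : gibbs_markov mu T P) (U : set X) k :
  saturated T P k U -> cvgn (escape_seq mu T U).
Proof.
move=> kU; have muT : measure_preserving mu T by case: GM.
have [mT mu_pre] := muT.
have mU := measurable_sat muT mP kU.
have mS t := measurable_survivors t mT mU.
have [K K1 sub] := survivors_submultiplicative mP genP GM kU.
have -> : escape_seq mu T U = (fun t : nat => ((t%:R^-1 : R)%:E *
    `|lne (fine (mu (survivors T U t)))%:E|)%E).
  apply/funext => t; rewrite /escape_seq entry_time_gt mu_pre//.
  by rewrite -prE.
apply: (submultiplicative_rate_cvg _ _ K1 sub).
  by move=> t; rewrite pr_ge0 pr_le1.
move=> t; apply: pr_le => // x Sx j jt; apply: Sx; exact: ltnW.
Qed.

(** * The localized escape rate *)

Local Open Scope ereal_scope.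

(** The survival estimates bound the lower and the upper escape rate of a hole without yielding a
    limit, hence the first two clauses; the third concerns holes whose escape rate exists. In the
    Gibbs-Markov case the last clause provides this existence. *)
Theorem corollary3 (R : realType) (M : pmetricType R)
    (compactM : compact [set: M])
    (mu : probability (borelType M) R)
    (T : borelType M -> borelType M)
    (muT : measure_preserving mu T)
    (P : set (set (borelType M)))
    (mP : measurable_partition P)
    (genP : generating T P)
    (U : nat -> set (borelType M))
    (goodU : good_neighborhood_system mu T P U)
    (periodU : essential_period mu T (U n) @[n --> \oo] --> +oo)
    (hyp :
      (exists phi : nat -> R, right_phi_mixing mu T P phi /\
         exists C p : R, [/\ (0 < C)%R, (1 < p)%R &
           forall k : nat, (0 < k)%N -> (phi k <= C * k%:R `^ (- p))%R]) \/
      (gibbs_markov mu T P /\ ergodic mu T)) :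
  [/\ lower_escape_rate mu T (U n) / mu (U n) @[n --> \oo] --> 1,
      upper_escape_rate mu T (U n) / mu (U n) @[n --> \oo] --> 1,
      (\forall n \near \oo, cvgn (escape_seq mu T (U n))) ->
        escape_rate mu T (U n) / mu (U n) @[n --> \oo] --> 1 &
      gibbs_markov mu T P ->
        forall n, cvgn (escape_seq mu T (U n))].
Proof.
have [kappa [_ satU _ _]] := good_neighborhoods muT mP goodU.
suff [L1 L2 L3] : [/\ lower_escape_rate mu T (U n) / mu (U n) @[n --> \oo] --> 1,
    upper_escape_rate mu T (U n) / mu (U n) @[n --> \oo] --> 1 &
    (\forall n \near \oo, cvgn (escape_seq mu T (U n))) ->
      escape_rate mu T (U n) / mu (U n) @[n --> \oo] --> 1].
  by split => // GM n; exact: gibbs_markov_escape_cvg (satU n).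
case: hyp => [[phi [phimix [C [p [C0 p1 philt]]]]]|[GM ergT]].
  exact: (localized_rates_of_phi_mixing muT mP phimix C0 p1 philt).
exact: (localized_rates_of_gibbs_markov mP genP GM ergT).
Qed.
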